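(* Let $G$ be any finite graph. Then the coefficients of the chromatic polynomial $\chi_G(t)$ form a log-concave sequence with no internal zeros; hence their absolute values form a unimodal sequence.
   Context: The chromatic polynomial $\chi_G(t)$ is the polynomial whose value at each positive integer $t$ is the number of proper colorings of the vertices of $G$ using $t$ colors, where a coloring is proper if adjacent vertices receive different colors. A sequence of real numbers $a_0,\dots,a_m$ is log-concave if $a_i^2\ge a_{i-1}a_{i+1}$ for all $i\in\{1,\dots,m-1\}$. It has no internal zeros if there are no indices $i<j<l$ with $a_i\neq 0$, $a_j=0$, $a_l\neq 0$. It is unimodal if there is an index $i\in\{0,\dots,m\}$ with $a_0\le\cdots\le a_{i-1}\le a_i\ge a_{i+1}\ge\cdots\ge a_m$. *)

(* Defs.v *)
From HB Require Import structures.
From mathcomp Require Import all_boot all_order all_algebra.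

Set Implicit Arguments.
Unset Strict Implicit.
Unset Printing Implicit Defensive.

Import Order.TTheory GRing.Theory Num.Theory.
Local Open Scope ring_scope.

(* Loops and parallel edges are allowed.  The ends of an edge are listed in an
   arbitrary order, which adjacency forgets; a loop makes its vertex adjacent
   to itself, so a graph with a loop has no proper coloring. *)
Record graph := Graph {
  vertex : finType;
  edge : finType;
  ends : edge -> vertex * vertex
}.

Definition adjacent (G : graph) (x y : vertex G) : bool :=
  [exists e : edge G, (ends e == (x, y)) || (ends e == (y, x))].

Definition proper (G : graph) (t : nat) (f : {ffun vertex G -> 'I_t}) : bool :=
  [forall x, forall y, adjacent x y ==> (f x != f y)].

Definition proper_colorings (G : graph) (t : nat) :
    {set {ffun vertex G -> 'I_t}} :=
  [set f | proper f].

Definition is_chromatic_poly (G : graph) (p : {poly int}) : Prop :=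
  forall t : nat, (0 < t)%N -> p.[t%:R] = #|proper_colorings G t|%:R.

(* Existence is by deletion-contraction along a list of vertex pairs. *)
Lemma coloring_count_poly (n : nat) (V : finType) (s : seq (V * V)) :
  size s = n ->
  {p : {poly int} | forall t : nat,
     p.[t%:R] = #|[set f : {ffun V -> 'I_t} |
                     all (fun e => f e.1 != f e.2) s]|%:R}.
Proof.
elim: n V s => [|n IHn] V [|[a b] s] //= => [_ | [sz_s]].
  exists 'X^#|V| => t; rewrite hornerXn -natrX.
  by rewrite -[in LHS](card_ord t) -card_ffun -cardsT; congr (#|_|%:R);
     apply/setP=> f; rewrite !inE.
case: (eqVneq a b) => [<-|neq_ab].
  exists 0 => t; rewrite horner0 [X in #|pred_of_set X|](_ : _ = set0) ?cards0 //.
  by apply/setP=> f; rewrite !inE eqxx.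
have [p0 p0E] := IHn V s sz_s.
pose W : finType := {x : V | x != a}.
have neq_ba : b != a by rewrite eq_sym.
pose wb : W := Sub b neq_ba.
pose g (x : V) : W := insubd wb x.
have [|p1 p1E] := IHn W [seq (g e.1, g e.2) | e <- s].
  by rewrite size_map.
exists (p0 - p1) => t; rewrite hornerD hornerN p0E p1E.
set A := [set f : {ffun V -> _} | _]; set B := [set f : {ffun W -> _} | _].
set C := [set f : {ffun V -> _} | _].
pose E := [set f : {ffun V -> 'I_t} | f a == f b].
pose lift (h : {ffun W -> 'I_t}) := [ffun x => h (g x)] : {ffun V -> 'I_t}.
have gK (w : W) : g (val w) = w by rewrite /g valKd.
have lift_inj : injective lift.
  move=> h1 h2 /ffunP eqh; apply/ffunP=> w.
  by have := eqh (val w); rewrite !ffunE gK.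
have ga : g a = wb by rewrite /g /insubd insubF ?eqxx.
have gb : g b = wb by rewrite -[b]/(val wb) gK.
have ->: #|B| = #|A :&: E|.
  rewrite -(card_imset _ lift_inj); congr #|pred_of_set _|.
  apply/setP=> f; apply/imsetP/idP => [[h hB ->] | ].
    move: hB; rewrite !inE all_map => hB; rewrite !ffunE ga gb eqxx andbT.
    by apply: sub_all hB => e /=; rewrite !ffunE.
  rewrite !inE => /andP[fA /eqP fab].
  have fg x : f (val (g x)) = f x.
    case: (eqVneq x a) => [->|xa]; first by rewrite ga /= fab.
    by rewrite /g val_insubd xa.
  exists [ffun w => f (val w)].
    by rewrite inE all_map; apply: sub_all fA => e /=; rewrite !ffunE !fg.
  by apply/ffunP=> x; rewrite !ffunE fg.
have ->: #|C| = #|A :\: E|.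
  by congr #|pred_of_set _|; apply/setP=> f; rewrite !inE.
by rewrite -(cardsID E A) natrD addrC addKr.
Qed.

Lemma chromatic_poly_exists (G : graph) :
  {p : {poly int} | is_chromatic_poly G p}.
Proof.
have [p pE] := coloring_count_poly (erefl (size [seq ends e | e : edge G])).
exists p => t _; rewrite pE; congr (#|pred_of_set _|%:R).
apply/setP=> f; rewrite !inE; apply/allP/forallP => [ok x | ok [x y]].
  apply/forallP=> y; apply/implyP=> /existsP[e /orP[] /eqP De].
    by apply: (ok (x, y)); rewrite -De; apply: map_f; rewrite mem_enum.
  by rewrite eq_sym; apply: (ok (y, x)); rewrite -De; apply: map_f;
     rewrite mem_enum.
case/mapP=> e _ De; have /forallP/(_ y)/implyP := ok x; apply.
by apply/existsP; exists e; rewrite -De eqxx.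
Qed.

Lemma chromatic_poly_unique (G : graph) (p q : {poly int}) :
  is_chromatic_poly G p -> is_chromatic_poly G q -> p = q.
Proof.
move=> pP qP; apply/eqP; rewrite -subr_eq0; apply/negPn/negP=> nz.
pose s : seq int := [seq i.+1%:R | i <- iota 0 (size (p - q))].
have := @max_poly_roots _ (p - q) s nz; rewrite size_map size_iota ltnn.
move=> absurd; apply/notF/absurd.
  apply/allP=> _ /mapP[i _ ->].
  by rewrite rootE hornerD hornerN pP // qP // subrr.
rewrite map_inj_uniq ?iota_uniq // => i j /eqP.
by rewrite eqr_nat eqSS => /eqP.
Qed.

Definition chromatic_poly (G : graph) : {poly int} :=
  sval (chromatic_poly_exists G).

Lemma chromatic_polyP (G : graph) : is_chromatic_poly G (chromatic_poly G).
Proof. exact: svalP (chromatic_poly_exists G). Qed.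

(* The finite sequence a_0, ..., a_m is given by m and a function on nat whose
   values beyond m are never inspected. *)
Definition log_concave (R : realDomainType) (m : nat) (a : nat -> R) : Prop :=
  forall i : nat, (1 <= i)%N -> (i < m)%N -> a i.-1 * a i.+1 <= a i ^+ 2.

Definition no_internal_zeros (R : realDomainType) (m : nat) (a : nat -> R) :
    Prop :=
  ~ exists i j l : nat,
      [/\ (i < j)%N, (j < l)%N & (l <= m)%N] /\
      [/\ a i != 0, a j = 0 & a l != 0].

Definition unimodal (R : realDomainType) (m : nat) (a : nat -> R) : Prop :=
  exists i : nat,
    [/\ (i <= m)%N,
        forall j : nat, (j < i)%N -> a j <= a j.+1 &
        forall j : nat, (i <= j)%N -> (j < m)%N -> a j.+1 <= a j].

(* The natural-number degree, with value 0 at the zero polynomial. *)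
Definition degree (p : {poly int}) : nat := (size p).-1.

(* Main.v *)
Require Import Defs.
From HB Require Import structures.
From mathcomp Require Import all_boot all_order all_algebra.
From mathcomp Require Import ring.

Set Implicit Arguments.
Unset Strict Implicit.
Unset Printing Implicit Defensive.

Import Order.TTheory GRing.Theory Num.Theory.
Local Open Scope ring_scope.

(** The chromatic polynomial is the sum of (-1)^|S| t^(n - rk S) over the sets
    S of edges, with n the number of vertices and rk the rank of the cycle
    matroid: expand the product over the edges of 1 - [both ends have the same
    color], and count the colorings that are constant along S.  Grouping the S
    by their closure, the coefficient of t^(n - k) is (-1)^k w_k, where w_k is
    the sum over the flats F of rank k of the weight m_F, the absolute value
    of the Moebius function from the empty flat to F.  A loop makes the
    polynomial zero; otherwise w_k > 0 exactly for k at most the rank.  So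
    everything rests on the log-concavity of the Whitney numbers w_k, which is
    proved here for all loopless matroids (the Heron-Rota-Welsh inequality).

    Fix an element i, and let s_k be the sum of m_F over the flats F of rank k
    through i.  By Weisner's theorem m_G is the sum of m_F over the hyperplanes
    F of G avoiding i, whence w_k = s_k + s_(k+1), and it suffices that s is
    log-concave.  In the Chow ring of the matroid, s_(k+1) is the degree of a
    monomial in two nef classes alpha and beta, and s_k s_(k+2) <= s_(k+1)^2 is
    the Hodge index inequality for the form x |-> deg(alpha^a beta^(k-1) x^2).
    In the basis of flats this form involves only the flats of ranks k and
    k + 1, with explicit coefficients.  That makes an elementary proof possible,
    in which no Chow ring appears.

    The claim (hodge_index_holds) is that the form is nonpositive on the
    orthogonal complement of beta, by induction on k.  Writing one factor beta
    as the sum of the flats avoiding i decomposes the form (bochner_identity)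
    into contributions of flats of three consecutive ranks.  Those of lowest
    rank are forms of rank-three geometries, each the square of a linear form
    minus a sum of squares (rank3_form); those of middle rank are products of
    two linear forms; those of highest rank are forms of the previous level, to
    which induction applies (top_form_le).  On the vectors that annihilate the
    first two kinds of linear forms, only the last contribution can be
    positive.  Averaging over i gives an inequality M <= M D M for the matrix M
    of the form reduced to flats of the top rank, where D is a diagonal matrix
    whose inverse maps a positive vector x to M x.  So, after rescaling, M has
    no eigenvalue strictly between 0 and 1, while Perron-Frobenius makes 1 its
    largest eigenvalue, with x as the only eigenvector: all other eigenvalues
    are nonpositive (nonpos_on_orthogonal). *)

(** * A Perron-Frobenius argument for symmetric matrices *)

(** The range of a symmetric matrix is the orthogonal complement of its
    kernel. *)
Lemma symmetric_range (K : fieldType) n (N : 'M[K]_n) (x : 'rV[K]_n) :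
    N^T = N -> x *m N = 0 ->
    (forall w : 'rV_n, w *m N = 0 -> (w <= x)%MS) ->
  forall g : 'rV_n, g *m x^T = 0 -> (g <= N)%MS.
Proof.
move=> symN xN0 kerN g gx0.
have sNk : (N <= kermx x^T)%MS.
  by apply/sub_kermxP; rewrite -[N]symN -trmx_mul xN0 trmx0.
have skx : (kermx N <= x)%MS.
  by apply/row_subP => i; apply: kerN; rewrite -row_mul mulmx_ker row0.
have skN : (kermx x^T <= N)%MS.
  rewrite -(geq_leqif (mxrank_leqif_sup sNk)) mxrank_ker mxrank_tr.
  by rewrite leq_subCl -mxrank_ker mxrankS.
by apply: submx_trans skN; apply/sub_kermxP.
Qed.

(** Put D = diag(x / y) and N = D^-1 - M.  As N is the Laplacian of a connected
    weighted graph, it is positive semidefinite with kernel spanned by x, and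
    the last hypothesis says N <= N D N.  A vector v orthogonal to y gives
    g = D^-1 v orthogonal to x, hence g = N w for some w.  Then
    w N w <= g D g = v g = v N w, and 0 <= (v - w) N (v - w) yields
    v D^-1 v = v N w <= v N v, that is, v M v <= 0. *)
Lemma nonpos_on_orthogonal (R : realFieldType) n (M : 'I_n -> 'I_n -> R)
    (x y : 'I_n -> R) :
    (forall i j, M i j = M j i) ->
    (forall i j, i != j -> 0 <= M i j) ->
    (forall i, 0 < x i) -> (forall i, 0 < y i) ->
    (forall i, \sum_j M i j * x j = y i) ->
    (forall f : 'I_n -> R,
       (forall i j, i != j -> 0 < M i j -> f i = f j) ->
       forall i j, f i = f j) ->
    (forall w : 'I_n -> R, \sum_i (\sum_j M i j * w j) * w i <=
       \sum_i x i / y i * (\sum_j M i j * w j) ^+ 2) ->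
  forall v : 'I_n -> R, \sum_i y i * v i = 0 ->
    \sum_i (\sum_j M i j * v j) * v i <= 0.
Proof.
move=> symM M_ge0 x_gt0 y_gt0 Mx conn bochner v yv0.
pose d i := y i / x i.
have xn0 i : x i != 0 by rewrite gt_eqF.
have yn0 i : y i != 0 by rewrite gt_eqF.
have form_sym (a b : 'I_n -> R) :
    \sum_i (\sum_j M i j * a j) * b i = \sum_i (\sum_j M i j * b j) * a i.
  under eq_bigr do rewrite mulr_suml.
  rewrite exchange_big; apply: eq_bigr => i _; rewrite mulr_suml.
  by apply: eq_bigr => j _; rewrite symM; ring.
have laplace (w : 'I_n -> R) :
    2 * (\sum_i d i * w i ^+ 2 - \sum_i (\sum_j M i j * w j) * w i) =
    \sum_i \sum_j M i j * x i * x j * (w i / x i - w j / x j) ^+ 2.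
  have -> : \sum_i \sum_j M i j * x i * x j * (w i / x i - w j / x j) ^+ 2 =
     \sum_i \sum_j (M i j * x j * (w i ^+ 2 / x i) +
       M j i * x i * (w j ^+ 2 / x j) - 2 * (M i j * w j * w i)).
    apply: eq_bigr => i _; apply: eq_bigr => j _; rewrite (symM j i).
    by field; rewrite !xn0.
  under [RHS]eq_bigr do rewrite sumrB big_split /=.
  rewrite sumrB big_split /= [X in _ + X - _]exchange_big /=.
  rewrite (_ : \sum_i \sum_j _ * (w i ^+ 2 / x i) = \sum_i d i * w i ^+ 2).
    under [X in _ = _ - X]eq_bigr do rewrite -mulr_sumr -mulr_suml.
    by rewrite -mulr_sumr; ring.
  by apply: eq_bigr => i _; rewrite -mulr_suml Mx /d; ring.
have term_ge0 (w : 'I_n -> R) i j :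
    0 <= M i j * x i * x j * (w i / x i - w j / x j) ^+ 2.
  have [<-|neq_ij] := eqVneq i j; first by rewrite subrr expr0n mulr0.
  by rewrite mulr_ge0 ?sqr_ge0 ?mulr_ge0 ?M_ge0 // ltW.
(* This w solves N w = g. *)
have [w wE] : exists w : 'I_n -> R,
    forall i, \sum_j M i j * w j = d i * (w i - v i).
  pose N : 'M[R]_n := \matrix_(i, j) ((i == j)%:R * d i - M i j).
  have NE (w : 'rV_n) i : (w *m N) 0 i = d i * w 0 i - \sum_j M i j * w 0 j.
    rewrite mxE; under eq_bigr do rewrite mxE mulrBr.
    rewrite sumrB (bigD1 i) //= eqxx mul1r big1 => [|j /negPf->]; last first.
      by rewrite mul0r mulr0.
    by rewrite addr0 mulrC; congr (_ - _); apply: eq_bigr => j _;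
       rewrite symM mulrC.
  have symN : N^T = N.
    by apply/matrixP => i j; rewrite !mxE symM eq_sym;
       have [->|] := eqVneq i j => //=; rewrite !mul0r.
  have xN0 : (\row_i x i) *m N = 0.
    apply/rowP => i; rewrite NE !mxE; under eq_bigr do rewrite mxE.
    by rewrite Mx /d; field.
  have kerN (w : 'rV_n) : w *m N = 0 -> (w <= \row_i x i)%MS.
    move=> wN0; have wx : forall i j, w 0 i / x i = w 0 j / x j.
      apply: conn => i j neq_ij Mij.
      have sum0 : \sum_i \sum_j
          M i j * x i * x j * (w 0 i / x i - w 0 j / x j) ^+ 2 = 0.
        rewrite -(laplace (fun i => w 0 i)) -sumrB big1 ?mulr0 // => k _.
        have /rowP/(_ k) := wN0; rewrite NE mxE => /subr0_eq <-; ring.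
      have rowi0 : \sum_j
          M i j * x i * x j * (w 0 i / x i - w 0 j / x j) ^+ 2 = 0.
        apply: (psumr_eq0P _ sum0) => // k _; apply: sumr_ge0 => l _.
        exact: (term_ge0 (fun i => w 0 i)).
      have /eqP := psumr_eq0P (fun l _ => term_ge0 (fun i => w 0 i) i l) rowi0
        (i := j) isT.
      rewrite mulf_eq0 sqrf_eq0 subr_eq0 => /orP[|/eqP//].
      by rewrite gt_eqF // !mulr_gt0.
    have [/eqP-> | [i0 i0n]] : w == 0 \/ exists i, w 0 i != 0.
    - have [->|/rV0Pn] := eqVneq w 0; [by left | by right].
    - exact: sub0mx.
    apply/sub_rVP; exists (w 0 i0 / x i0); apply/rowP => i; rewrite !mxE.
    by rewrite (wx i0 i) divfK.
  have [|w wE] := submxP (symmetric_range symN xN0 kerN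
      (g := \row_i (d i * v i)) _).
    apply/rowP => i; rewrite !mxE -[RHS]yv0; apply: eq_bigr => j _.
    by rewrite !mxE /d; field.
  exists (fun i => w 0 i) => i; have /rowP/(_ i) := wE.
  by rewrite NE mxE mulrBr => ->; ring.
have h1 : \sum_i d i * w i * v i <= \sum_i d i * v i ^+ 2.
  rewrite -subr_ge0 (_ : _ - _ = \sum_i x i / y i * (\sum_j M i j * w j) ^+ 2 -
    \sum_i (\sum_j M i j * w j) * w i) ?subr_ge0 //.
  rewrite -!sumrB; apply: eq_bigr => i _.
  by rewrite wE /d; field; rewrite xn0 yn0.
have h2 : 0 <= \sum_i d i * (v i - w i) ^+ 2 -
    \sum_i (\sum_j M i j * (v j - w j)) * (v i - w i).
  rewrite -(pmulr_rge0 _ (ltr0Sn R 1)) (laplace (fun i => v i - w i)).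
  apply: sumr_ge0 => i _; apply: sumr_ge0 => j _.
  exact: (term_ge0 (fun i => v i - w i)).
have h3 : \sum_i (\sum_j M i j * (v j - w j)) * (v i - w i) =
    \sum_i (\sum_j M i j * v j) * v i +
    \sum_i (d i * (w i - v i) * w i - 2 * (d i * (w i - v i) * v i)).
  have -> : \sum_i (d i * (w i - v i) * w i - 2 * (d i * (w i - v i) * v i)) =
     \sum_i (\sum_j M i j * w j) * w i - \sum_i (\sum_j M i j * w j) * v i
     - \sum_i (\sum_j M i j * v j) * w i.
    rewrite (form_sym v w) -!sumrB; apply: eq_bigr => i _; rewrite wE; ring.
  rewrite -!sumrB -big_split /=; apply: eq_bigr => i _.
  under eq_bigr do rewrite mulrBr.
  by rewrite sumrB; ring.
rewrite -oppr_ge0 -(addr0 (- _)); apply: le_trans h2 _.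
rewrite h3 opprD addrCA lerD2l -[X in _ <= X](subrr (\sum_i d i * v i ^+ 2)).
rewrite -sumrB (le_trans _ (lerB h1 (lexx _))) // -sumrB.
rewrite le_eqVlt; apply/orP; left; apply/eqP.
by apply: eq_bigr => i _; ring.
Qed.

(** * Matroids and their flats *)

(** Instead of global submodularity, the last axiom asks only that two elements
    which separately leave the rank of S unchanged also do so jointly. *)
Record matroid (T : finType) := Matroid {
  rank :> {set T} -> nat;
  rank_set0 : rank set0 = 0%N;
  rank_setU1 : forall S i, (rank S <= rank (i |: S) <= (rank S).+1)%N;
  rank_parallel : forall S i j, rank (i |: S) = rank S ->
    rank (j |: S) = rank S -> rank (i |: (j |: S)) = rank S
}.

Section Flats.
Variables (T : finType) (r : matroid T).
Implicit Types (S X F G H E : {set T}) (i j : T) (k : nat).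

Lemma superset_ind (P : {set T} -> Prop) S :
    P S -> (forall X i, S \subset X -> P X -> P (i |: X)) ->
  forall X : {set T}, S \subset X -> P X.
Proof.
move=> PS PU X; have [n] := ubnP #|X|; elim: n X => // n IHn X leXn sSX.
have [-> // | neqSX] := eqVneq X S.
have [i iX iS] : exists2 i, i \in X & i \notin S.
  by apply/subsetPn; apply: contra neqSX => sXS; rewrite eqEsubset sXS.
rewrite -(setD1K iX); apply: PU; first by rewrite subsetD1 sSX.
apply: IHn; last by rewrite subsetD1 sSX.
by rewrite (cardsD1 i) iX add1n ltnS in leXn.
Qed.

Lemma rank_mono S X : S \subset X -> (r S <= r X)%N.
Proof.
move: X; apply: superset_ind => // X i _ /leq_trans; apply.
by case/andP: (rank_setU1 r X i).
Qed.

Definition closure S := [set i | r (i |: S) == r S].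

Lemma closureP S i : reflect (r (i |: S) = r S) (i \in closure S).
Proof. by rewrite inE; apply: eqP. Qed.

Lemma sub_closure S : S \subset closure S.
Proof.
by apply/subsetP => i iS; apply/closureP; rewrite (setUidPr _) ?sub1set.
Qed.

Lemma rank_notin_closure S i : i \notin closure S -> r (i |: S) = (r S).+1.
Proof.
rewrite inE => neq; apply/eqP; rewrite eqn_leq.
by case/andP: (rank_setU1 r S i) => le1 ->; rewrite ltn_neqAle eq_sym neq.
Qed.

Lemma closure_mono S X : S \subset X -> closure S \subset closure X.
Proof.
move=> sSX; apply/subsetP => i iS; move: X sSX.
apply: superset_ind => // X j _ /closureP iX; apply/closureP.
have [/closureP jX|/rank_notin_closure jX] := boolP (j \in closure X).
  by rewrite (rank_parallel iX jX).
apply/eqP; rewrite eqn_leq; case/andP: (rank_setU1 r (j |: X) i) => -> _.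
rewrite andbT setUCA; case/andP: (rank_setU1 r (i |: X) j) => _.
by rewrite iX jX.
Qed.

Lemma rank_closure S : r (closure S) = r S.
Proof.
suff: forall X, S \subset X -> X \subset closure S -> r X = r S.
  by apply=> //; apply: sub_closure.
apply: superset_ind => // X i sSX IH; rewrite subUset sub1set => /andP[iS sXS].
by rewrite -(IH sXS); apply/closureP; apply: subsetP (closure_mono sSX) i iS.
Qed.

Lemma closure_id S : closure (closure S) = closure S.
Proof.
apply/eqP; rewrite eqEsubset sub_closure andbT; apply/subsetP => i /closureP.
rewrite rank_closure => riS; apply/closureP/eqP; rewrite eqn_leq.
case/andP: (rank_setU1 r S i) => -> _; rewrite andbT -riS rank_mono //.
exact/setUS/sub_closure.
Qed.

Definition flat F := closure F == F.

Lemma flat_closure S : flat (closure S).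
Proof. by rewrite /flat closure_id. Qed.

Lemma closure_sub_flat S F : flat F -> (closure S \subset F) = (S \subset F).
Proof.
move=> /eqP fF; apply/idP/idP; first exact/subset_trans/sub_closure.
by rewrite -{2}fF; apply: closure_mono.
Qed.

Lemma rank_flatU1 F i : flat F -> i \notin F -> r (i |: F) = (r F).+1.
Proof. by move=> /eqP fF; rewrite -{1}fF; apply: rank_notin_closure. Qed.

Lemma flat_eq F G : flat F -> F \subset G -> (r G <= r F)%N -> F = G.
Proof.
move=> fF sFG leGF; apply/eqP; rewrite eqEsubset sFG /=.
apply/subsetP => i iG; apply: contraLR leGF => iF; rewrite -ltnNge.
by rewrite -(rank_flatU1 fF iF) rank_mono // subUset sub1set iG.
Qed.

Lemma flatT : flat setT.
Proof. by rewrite /flat eqEsubset subsetT sub_closure. Qed.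

Lemma flatI F G : flat F -> flat G -> flat (F :&: G).
Proof.
move=> fF fG; rewrite /flat eqEsubset sub_closure andbT subsetI.
by rewrite !closure_sub_flat // subsetIl subsetIr.
Qed.

Definition flats k H := [set F | [&& flat F, F \subset H & r F == k]].

Lemma flatsP k H F :
  reflect [/\ flat F, F \subset H & r F = k] (F \in flats k H).
Proof. by rewrite inE; apply: (iffP and3P) => -[-> -> /eqP]. Qed.

Lemma flats_sub k G H F :
  G \subset H -> (F \in flats k G) = (F \in flats k H) && (F \subset G).
Proof.
move=> sGH; rewrite !inE -!andbA; case: (boolP (F \subset G)) => [sFG|_].
  by rewrite (subset_trans sFG sGH) andbT.
by rewrite !andbF.
Qed.

Lemma closureU1_flats k H F i :
  flat H -> F \in flats k H -> i \in H -> i \notin F ->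
  closure (i |: F) \in flats k.+1 H.
Proof.
move=> fH /flatsP[fF sFH <-] iH iF; apply/flatsP; split.
- exact: flat_closure.
- by rewrite closure_sub_flat // subUset sub1set iH.
- by rewrite rank_closure rank_flatU1.
Qed.

Lemma mem_closureU1 F i : i \in closure (i |: F).
Proof. by apply: subsetP (sub_closure _) _ _; rewrite setU11. Qed.

Lemma sub_closureU1 F i : F \subset closure (i |: F).
Proof. exact: subset_trans (subsetUr _ _) (sub_closure _). Qed.

(** The flats covering F partition the elements outside F. *)
Lemma cover_eq k H F G i :
  F \in flats k H -> G \in flats k.+1 H -> F \subset G -> i \in G ->
  i \notin F -> G = closure (i |: F).
Proof.
move=> /flatsP[fF _ rF] /flatsP[fG _ rG] sFG iG iF; apply/esym/flat_eq.
- exact: flat_closure.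
- by rewrite closure_sub_flat // subUset sub1set iG.
- by rewrite rank_closure rank_flatU1 // rF rG.
Qed.

Lemma big_cover_mem (R : nmodType) (f : {set T} -> R) k H F i :
  flat H -> F \in flats k H -> i \in H -> i \notin F ->
  \sum_(G in flats k.+1 H | (F \subset G) && (i \in G)) f G =
  f (closure (i |: F)).
Proof.
move=> fH FH iH iF; apply: big_pred1 => G /=.
apply/andP/eqP => [[GH /andP[sFG iG]] | ->]; first exact: cover_eq GH sFG iG iF.
by rewrite closureU1_flats // sub_closureU1 mem_closureU1.
Qed.

(** Enlarge F inside G as long as possible while avoiding i: as j is not in the
    closure of F and i, by exchange i is not in the closure of F and j. *)
Lemma cover_avoiding F G i :
    flat F -> flat G -> F \subset G -> i \in G -> i \notin F ->
  exists k E, [/\ E \in flats k G, r G = k.+1, F \subset E & i \notin E].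
Proof.
move=> + fG; have [n] := ubnP (r G - r F)%N; elim: n F => // n IHn F.
rewrite ltnS => le_n fF sFG iG iF.
have rlt : (r (i |: F) <= r G)%N by rewrite rank_mono // subUset sub1set iG.
rewrite rank_flatU1 // in rlt.
move: (rlt); rewrite leq_eqVlt => /orP[/eqP <- | rlt2].
  by exists (r F), F; split=> //; apply/flatsP.
have [j jG jFi] : exists2 j, j \in G & j \notin closure (i |: F).
  apply/subsetPn; apply: contraTN rlt2 => /rank_mono.
  by rewrite rank_closure rank_flatU1 // -leqNgt.
have jF : j \notin F by apply: contra jFi; apply: subsetP (sub_closureU1 F i) j.
have FG : F \in flats (r F) G by apply/flatsP.
have F'G := closureU1_flats fG FG jG jF.
case/flatsP: (F'G) => fF' sF'G rF'.
have iF' : i \notin closure (j |: F).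
  apply: contra jFi => iF'; rewrite -(cover_eq FG F'G) ?mem_closureU1 //.
  exact: sub_closureU1.
have [|k [E [EG rG sE iE]]] := IHn _ _ fF' sF'G iG iF'.
  by rewrite rF' (leq_trans _ le_n) // subnS prednK // subn_gt0.
by exists k, E; split=> //; apply: subset_trans sE; apply: sub_closureU1.
Qed.

End Flats.

(** * Moebius weights of flats *)

Section Weights.
Variables (T : finType) (r : matroid T) (R : realFieldType).
Implicit Types (S X F G H E : {set T}) (i j : T) (k : nat).
Local Notation closure := (closure r).
Local Notation flats := (flats r).

(** By Whitney, the sum of (-1)^|S| over the spanning sets S of F is the value
    at F of the Moebius function of the lattice of flats; the sign (-1)^(r F)
    makes it nonnegative. *)
Definition weight F : R := \sum_(S | closure S == F) (-1) ^+ (#|S| + r F).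

(** Adding or removing i pairs off the sets S with opposite signs. *)
Lemma toggle_sum i G :
  \sum_(S | closure (i |: S) == G) (-1) ^+ #|S| = 0 :> R.
Proof.
rewrite (bigID (fun S => i \in S)) /=.
rewrite (reindex_onto (fun S => i |: S) (fun S => S :\ i)) /=; last first.
  by move=> S /andP[_ iS]; rewrite setD1K.
rewrite [X in X + _](_ : _ =
    \sum_(S | (closure (i |: S) == G) && (i \notin S)) - (-1) ^+ #|S|).
  by rewrite -big_split big1 //= => S _; rewrite addNr.
apply: eq_big => S => [|/andP[_ /eqP SE]].
  rewrite setUA setUid setU11 andbT; congr (_ && _); apply/eqP/idP => [<-|iS].
    by rewrite !inE eqxx.
  by rewrite setU1K.
have iS : i \notin S by rewrite -SE !inE eqxx.
by rewrite cardsU1 iS exprD expr1 mulN1r.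
Qed.

Lemma closure_setU1_closure i S : closure (i |: closure S) = closure (i |: S).
Proof.
apply/eqP; rewrite eqEsubset !closure_sub_flat ?flat_closure //.
rewrite !subUset !sub1set !mem_closureU1 closure_sub_flat ?flat_closure //.
by rewrite sub_closureU1 (subset_trans (sub_closure r S)) ?sub_closureU1.
Qed.

Lemma closure_flat F : flat r F -> closure F = F.
Proof. by move/eqP. Qed.

(** Group the sum of toggle_sum by closure: the flats F with F joined to i
    equal to G are G itself and the hyperplanes of G avoiding i. *)
Lemma weisner k H G i : G \in flats k.+1 H -> i \in G ->
  \sum_(F in flats k G | i \notin F) weight F = weight G.
Proof.
move=> /flatsP[fG sGH rG] iG.
have GG : G \in flats k.+1 G by apply/flatsP.
have /eqP := toggle_sum i G.
rewrite (partition_big closure (flat r)) => [|S _]; last exact: flat_closure.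
rewrite (eq_bigr (fun F => \sum_(S | (closure (i |: F) == G) &&
    (closure S == F)) (-1) ^+ #|S|)) => [|F fF]; last first.
  apply: eq_bigl => S; case: (closure S =P F) => [<-|]; rewrite ?andbF //.
  by rewrite closure_setU1_closure.
rewrite (bigD1 G) //= (setUidPr _) ?sub1set // closure_flat // eqxx /=.
have wE k' F : r F = k' ->
    \sum_(S | closure S == F) (-1) ^+ #|S| = (-1) ^+ k' * weight F.
  move=> <-; rewrite mulr_sumr; apply: eq_bigr => S _.
  by rewrite addnC exprD signrMK.
rewrite (wE k.+1) // (bigID (fun F => closure (i |: F) == G)) /=.
rewrite [X in _ + X]addrC.
rewrite big1 => [|F /andP[_ /negPf->]]; last by rewrite big_pred0_eq.
rewrite add0r addrC addr_eq0 => /eqP e; apply: (can_inj (signrMK k)).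
rewrite [RHS](_ : _ = - ((-1) ^+ k.+1 * weight G)); last first.
  by rewrite exprS mulN1r mulNr opprK.
rewrite -e mulr_sumr.
apply: eq_big => [F | F /andP[FG iF]]; last first.
  have /flatsP[_ sFG rF] := FG.
  by rewrite -(cover_eq FG GG sFG iG iF) eqxx (wE k).
apply/andP/andP => [[FG iF] | [/andP[fF neqFG] /eqP FG]].
  case/flatsP: (FG) => fF sFG rF; split; last first.
    by rewrite -(cover_eq FG GG sFG iG iF).
  by rewrite fF; apply: contraNneq iF => ->.
have sFG : F \subset G by rewrite -FG sub_closureU1.
have iF : i \notin F.
  apply: contra neqFG => iF.
  by rewrite -FG (setUidPr _) ?sub1set // closure_flat.
split=> //; apply/flatsP; split=> //; apply/eqP; rewrite -eqSS.
by rewrite -(rank_flatU1 fF iF) -rG -FG rank_closure.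
Qed.

(** Apply Weisner's theorem to each F on the right-hand side; each E on the
    left then occurs once, below the closure of E and i. *)
Lemma weisner_shift k H i : flat r H -> i \in H ->
  \sum_(E in flats k H | i \notin E) weight E =
  \sum_(F in flats k.+1 H | i \in F) weight F.
Proof.
move=> fH iH; transitivity (\sum_(F in flats k.+1 H | i \in F)
    \sum_(E in flats k F | i \notin E) weight E); last first.
  by apply: eq_bigr => F /andP[FH iF]; apply: weisner FH iF.
rewrite [RHS](exchange_big_dep (fun E => (E \in flats k H) && (i \notin E))) /=.
  apply: eq_bigr => E /andP[EH iE].
  rewrite -[LHS](big_cover_mem (fun=> weight E) fH EH iH iE).
  apply: eq_bigl => F; rewrite iE andbT -!andbA; case FH: (F \in _) => //=.
  by have /flatsP[_ sFH _] := FH; rewrite (flats_sub _ _ _ sFH) EH andbC.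
move=> F E /andP[/flatsP[_ sFH _] _].
by rewrite (flats_sub _ _ _ sFH) => /andP[/andP[-> _] ->].
Qed.

(** For G of rank k + 1 and any i in G, this is the total weight of the
    hyperplanes of G through i; the definition shows that it does not depend on
    the choice of i. *)
Definition coweight k G : R := \sum_(F in flats k G) weight F - weight G.

Lemma coweight_mem k H G i : G \in flats k.+1 H -> i \in G ->
  \sum_(F in flats k G | i \in F) weight F = coweight k G.
Proof.
move=> GH iG; rewrite /coweight -(weisner GH iG).
by rewrite [in RHS](bigID (fun F => i \in F)) /= addrK.
Qed.

Lemma sum_weight_avoiding k H F i : F \in flats k.+1 H ->
  \sum_(E in flats k F | i \notin E) weight E =
  weight F + (i \notin F)%:R * coweight k F.
Proof.
move=> FH; case: (boolP (i \in F)) => iF.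
  by rewrite (weisner FH iF) mul0r addr0.
rewrite mul1r /coweight addrC subrK; apply: eq_bigl => E.
case EF: (E \in _) => //=; apply: contra iF; apply: subsetP.
by case/flatsP: EF.
Qed.

Lemma sum_weight2_avoiding k H G i : G \in flats k.+2 H ->
  \sum_(E in flats k G | i \notin E) weight E =
  coweight k.+1 G +
  (i \notin G)%:R * (\sum_(E in flats k G) weight E - coweight k.+1 G).
Proof.
move=> GH; have /flatsP[fG _ _] := GH; case: (boolP (i \in G)) => iG.
  by rewrite weisner_shift // (coweight_mem GH iG) mul0r addr0.
rewrite mul1r addrC subrK; apply: eq_bigl => E.
case EG: (E \in _) => //=; apply: contra iG; apply: subsetP.
by case/flatsP: EG.
Qed.

Hypothesis loopless : closure set0 = set0.

Lemma flat_set0 : flat r set0.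
Proof. by rewrite /flat loopless. Qed.

Lemma flats0 H : flats 0 H = [set set0].
Proof.
apply/setP => F; rewrite inE; apply/flatsP/eqP => [[fF _ rF] | ->].
  by apply/esym/(flat_eq flat_set0); rewrite ?sub0set ?rF.
by rewrite flat_set0 sub0set rank_set0.
Qed.

Lemma weight_set0 : weight set0 = 1.
Proof.
rewrite /weight (big_pred1 set0) ?cards0 ?rank_set0 // => S /=.
apply/eqP/eqP => [eS|->//]; apply/eqP; rewrite -subset0 -eS.
exact: sub_closure.
Qed.

Lemma weight_gt0 k H F : F \in flats k H -> 0 < weight F.
Proof.
elim: k H F => [|k IHk] H F FH.
  by move: FH; rewrite flats0 => /set1P->; rewrite weight_set0.
have /flatsP[fF _ rF] := FH.
have [F0 | [i iF]] := set_0Vmem F; first by rewrite F0 rank_set0 in rF.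
have := cover_avoiding flat_set0 fF (sub0set F) iF.
rewrite inE => /(_ isT)[k' [E [EF]]]; rewrite rF => -[ek] _ iE.
rewrite -{k'}ek in EF; rewrite -(weisner FH iF) (bigD1 E) ?EF //=.
rewrite ltr_pwDl ?(IHk _ _ EF) // sumr_ge0 // => E' /andP[/andP[E'F _] _].
exact/ltW/(IHk _ _ E'F).
Qed.

End Weights.

(** * The intersection form and its Bochner identity *)

Section IntersectionForm.
Variables (T : finType) (r : matroid T) (R : realFieldType).
Implicit Types (S X F G H E : {set T}) (i j : T) (k : nat) (z : {set T} -> R).
Local Notation closure := (closure r).
Local Notation flats := (flats r).
Local Notation weight := (@weight T r R).
Local Notation coweight := (@coweight T r R).

(** The number of flats of rank k + 1 below H that contain F, as a scalar. *)
Definition covers k H F : R := \sum_(G in flats k.+1 H | F \subset G) 1.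

Definition up_sum k H z F := \sum_(G in flats k.+1 H | F \subset G) z G.

Definition upper_row k z G :=
  \sum_(F in flats k G) weight F * z F - coweight k G * z G.

Definition lower_row k H z F := up_sum k H z F - (covers k H F - 1) * z F.

(** For k > 0 this is the pairing deg(alpha^a beta^(k-1) z z') of the Chow ring
    of the interval below H, which sees only the flats of ranks k and k + 1; a
    vector z stands for the class that has coordinate z F on the generator of F.
    For G covering F, the generators of F and G have product m_F; the square of
    the generator of F is - (c - 1) m_F, with c covers of F, and the square of
    the generator of G is minus the coweight of G. *)
Definition form k H z z' :=
  \sum_(G in flats k.+1 H) upper_row k z G * z' G +
  \sum_(F in flats k H) weight F * lower_row k H z F * z' F.

Lemma exchange_flats_cond k l H (P : pred {set T})
    (f : {set T} -> {set T} -> R) :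
  \sum_(G in flats l H) \sum_(F in flats k G | P F) f F G =
  \sum_(F in flats k H | P F) \sum_(G in flats l H | F \subset G) f F G.
Proof.
rewrite (exchange_big_dep (fun F => (F \in flats k H) && P F)) /=.
  apply: eq_bigr => F /andP[FH PF]; apply: eq_bigl => G.
  case GH: (G \in _) => //=; have /flatsP[_ sGH _] := GH.
  by rewrite (flats_sub _ _ _ sGH) FH PF andbT.
move=> G F /flatsP[_ sGH _]; rewrite (flats_sub _ _ _ sGH).
by move=> /andP[/andP[-> _] ->].
Qed.

Lemma exchange_flats k H (f : {set T} -> {set T} -> R) :
  \sum_(G in flats k.+1 H) \sum_(F in flats k G) f F G =
  \sum_(F in flats k H) \sum_(G in flats k.+1 H | F \subset G) f F G.
Proof.
have := exchange_flats_cond k k.+1 H xpredT f.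
under eq_bigr do under eq_bigl do rewrite andbT.
by under [X in _ = X -> _]eq_bigl do rewrite andbT.
Qed.

Lemma formE k H z z' : form k H z z' =
    \sum_(F in flats k H) weight F * (up_sum k H z F * z' F +
      z F * up_sum k H z' F - (covers k H F - 1) * z F * z' F) -
    \sum_(G in flats k.+1 H) coweight k G * z G * z' G.
Proof.
rewrite /form; under eq_bigr do rewrite mulrBl mulr_suml.
rewrite sumrB exchange_flats addrAC -big_split /=; congr (_ - _).
apply: eq_bigr => F _; rewrite -mulr_sumr /lower_row.
rewrite [X in X + _](_ : _ = weight F * (z F * up_sum k H z' F)); last first.
  by rewrite /up_sum !mulr_sumr; apply: eq_bigr => G _; rewrite mulrA.
by ring.
Qed.

Lemma form_sym k H z z' : form k H z z' = form k H z' z.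
Proof. by rewrite !formE; congr (_ - _); apply: eq_bigr => F _; ring. Qed.

Lemma form_diag k H z : form k H z z =
    \sum_(F in flats k H) weight F *
      (2 * z F * up_sum k H z F - (covers k H F - 1) * z F ^+ 2) -
    \sum_(G in flats k.+1 H) coweight k G * z G ^+ 2.
Proof.
by rewrite formE; congr (_ - _); apply: eq_bigr => F _; ring.
Qed.

Lemma covers_avoiding k H F i :
  flat r H -> F \in flats k H -> i \in H ->
  \sum_(G in flats k.+1 H | (F \subset G) && (i \notin G)) 1 =
  (i \notin F)%:R * (covers k H F - 1).
Proof.
move=> fH FH iH; case: (boolP (i \in F)) => iF.
  rewrite mul0r big1 // => G /andP[_ /andP[/subsetP/(_ i iF)-> //]].
rewrite mul1r /covers; apply/eqP; rewrite -subr_eq0 opprB addrA; apply/eqP.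
rewrite [X in _ - X](bigID (fun G => i \in G)) /=.
under [X in _ - (X + _)]eq_bigl do rewrite -andbA.
rewrite (big_cover_mem (fun=> 1) fH FH iH iF).
by under [X in _ - (_ + X)]eq_bigl do rewrite -andbA; ring.
Qed.

(** Exactly one of the flats covering F contains i, unless F does. *)
Lemma sum_avoiding k H i (f : {set T} -> R) : flat r H -> i \in H ->
  \sum_(G in flats k.+1 H | i \notin G) \sum_(F in flats k G) f F =
  \sum_(F in flats k H | i \notin F) (covers k H F - 1) * f F.
Proof.
move=> fH iH.
rewrite big_mkcondr /=.
transitivity (\sum_(G in flats k.+1 H) \sum_(F in flats k G)
   ((i \notin G)%:R * f F)).
  apply: eq_bigr => G _; rewrite -mulr_sumr.
  by case: (i \in G); rewrite ?mul1r ?mul0r.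
rewrite exchange_flats [RHS]big_mkcondr /=; apply: eq_bigr => F FH.
rewrite -mulr_suml (_ : \sum_(G in _ | _) _ =
  (i \notin F)%:R * (covers k H F - 1)).
  by case: (i \in F); rewrite ?mul1r ?mul0r.
rewrite -covers_avoiding // [RHS]big_mkcond [LHS]big_mkcond /=.
by apply: eq_bigr => G _; case: (G \in _); case: (F \subset G); case: (i \in G).
Qed.

(** In the geometry of points and lines above E, a line through the point F and
    another point F' is unique, whereas F itself lies on covers k.+1 H F
    lines. *)
Lemma sum_lines_through k H E F (f : {set T} -> R) :
  flat r H -> E \in flats k H -> F \in flats k.+1 H -> E \subset F ->
  \sum_(G in flats k.+2 H | F \subset G)
     \sum_(F' in flats k.+1 G | E \subset F') f F' =
  \sum_(F' in flats k.+1 H | E \subset F') f F' + (covers k.+1 H F - 1) * f F.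
Proof.
move=> fH EH FH sEF; transitivity
    (\sum_(F' in flats k.+1 H | E \subset F')
      \sum_(G in flats k.+2 H | (F \subset G) && (F' \subset G)) f F').
  rewrite (exchange_big_dep
    (fun F' => (F' \in flats k.+1 H) && (E \subset F'))) /=.
    apply: eq_bigr => F' /andP[F'H sEF']; apply: eq_bigl => G.
    case GH: (G \in _) => //=; have /flatsP[_ sGH _] := GH.
    by rewrite (flats_sub _ _ _ sGH) F'H sEF' andbT.
  move=> G F' /andP[/flatsP[_ sGH _] _].
  by rewrite (flats_sub _ _ _ sGH) => /andP[/andP[-> _] ->].
rewrite (bigD1 F) ?FH //= [X in _ = X + _](bigD1 F) ?FH //=.
rewrite [X in X + _](_ : _ = covers k.+1 H F * f F); last first.
  rewrite /covers mulr_suml; apply: eq_big => G; first by rewrite andbb.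
  by rewrite mul1r.
rewrite [X in _ + X](eq_bigr f) => [|F' /andP[/andP[F'H sEF'] neqF]].
  by ring.
have [i iF' iF] : exists2 i, i \in F' & i \notin F.
  apply/subsetPn; apply: contra neqF => sF'F.
  have /flatsP[fF' _ rF'] := F'H; have /flatsP[_ _ rF] := FH.
  by apply/eqP/(flat_eq fF' sF'F); rewrite rF rF'.
have iH : i \in H by have /flatsP[_ /subsetP->] := F'H.
rewrite -[RHS](big_cover_mem (fun=> f F') fH FH iH iF); apply: eq_bigl => G.
case GH: (G \in _) => //=; case sFG: (F \subset G) => //=.
apply/idP/idP => [/subsetP-> // | iG].
have iE : i \notin E by apply: contra iF; apply: subsetP.
have F'G : F' = closure (i |: E) by apply: cover_eq EH F'H sEF' iF' iE.
have /flatsP[fG _ _] := GH.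
rewrite F'G closure_sub_flat // subUset sub1set iG.
exact: subset_trans sEF sFG.
Qed.


Lemma exchange_lines k H E (f g : {set T} -> R) :
  \sum_(G in flats k.+2 H | E \subset G) g G * up_sum k G f E =
  \sum_(F in flats k.+1 H | E \subset F) f F * up_sum k.+1 H g F.
Proof.
under eq_bigr do rewrite mulr_sumr.
rewrite (exchange_big_dep
  (fun F => (F \in flats k.+1 H) && (E \subset F))) /=.
  apply: eq_bigr => F /andP[FH sEF]; rewrite mulr_sumr.
  apply: eq_big => [G | G _]; last exact: mulrC.
  case GH: (G \in _) => //=; have /flatsP[_ sGH _] := GH.
  rewrite (flats_sub _ _ _ sGH) FH sEF andbT.
  by case sFG: (F \subset G); rewrite ?andbF // (subset_trans sEF sFG).
move=> G F /andP[/flatsP[_ sGH _] _].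
by rewrite (flats_sub _ _ _ sGH) => /andP[/andP[-> _] ->].
Qed.

(** The form of a rank-three geometry is a square minus a sum of squares: above
    E, two distinct points lie on one line, so in the square of the sum over all
    points the mixed terms are those of the squares of the sums over lines. *)
Lemma rank3_form k H E i z :
  flat r H -> E \in flats k H -> i \in H -> i \notin E ->
  lower_row k H z E ^+ 2 - \sum_(G in flats k.+2 H | E \subset G)
     (z G - z E - up_sum k G (fun F => z F - z E) E) ^+ 2 =
  \sum_(F in flats k.+1 H | E \subset F)
     (2 * z F * up_sum k.+1 H z F - (covers k.+1 H F - 1) * z F ^+ 2)
  - \sum_(G in flats k.+2 H | E \subset G) z G ^+ 2
  - 2 * z E * \sum_(G in flats k.+2 H | E \subset G) (covers k G E - 1) * z G
  + z E ^+ 2 * \sum_(G in flats k.+2 H | (E \subset G) && (i \notin G))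
                 (covers k G E - 1).
Proof.
move=> fH EH iH iE; set a := z E; pose y F := z F - a.
have upB X : up_sum k X y E = up_sum k X z E - covers k X E * a.
  rewrite /up_sum /covers mulr_suml -sumrB; apply: eq_bigr => F _.
  by rewrite mul1r.
have lines (f : {set T} -> R) F : F \in flats k.+1 H -> E \subset F ->
    up_sum k.+1 H (fun G => up_sum k G f E) F =
    up_sum k H f E + (covers k.+1 H F - 1) * f F.
  by move=> FH sEF; apply: sum_lines_through.
have sqY : \sum_(G in flats k.+2 H | E \subset G) up_sum k G y E ^+ 2 =
    up_sum k H y E ^+ 2 + \sum_(F in flats k.+1 H | E \subset F)
                            (covers k.+1 H F - 1) * (z F - a) ^+ 2.
  under eq_bigr do rewrite expr2.
  rewrite exchange_lines [X in X ^+ 2]/up_sum expr2 mulr_suml -big_split /=.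
  apply: eq_bigr => F /andP[FH sEF].
  by rewrite lines // -/(up_sum k H y E) -/(y F); ring.
have up1 h X F : up_sum h X (fun=> 1) F = covers h X F by [].
pose A1 := \sum_(G in flats k.+2 H | E \subset G) z G ^+ 2.
pose A2 := \sum_(G in flats k.+2 H | E \subset G) z G.
pose N : R := \sum_(G in flats k.+2 H | E \subset G) 1.
pose A3 := \sum_(G in flats k.+2 H | E \subset G) z G * up_sum k G z E.
pose A4 := \sum_(G in flats k.+2 H | E \subset G) covers k G E * z G.
pose A5 := \sum_(G in flats k.+2 H | E \subset G) up_sum k G z E.
pose A6 := \sum_(G in flats k.+2 H | E \subset G) covers k G E.
pose B1 := \sum_(F in flats k.+1 H | E \subset F)
   (covers k.+1 H F - 1) * z F ^+ 2.
pose B2 := \sum_(F in flats k.+1 H | E \subset F) (covers k.+1 H F - 1) * z F.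
pose B3 := \sum_(F in flats k.+1 H | E \subset F) (covers k.+1 H F - 1).
have A3E : \sum_(F in flats k.+1 H | E \subset F) z F * up_sum k.+1 H z F = A3.
  by rewrite /A3 exchange_lines.
have A5E : A5 = B2 + up_sum k H z E.
  rewrite /A5; under eq_bigr do rewrite -[up_sum k _ z E]mul1r.
  rewrite (exchange_lines _ _ _ _ (fun=> 1)) /B2 -big_split /=.
  by apply: eq_bigr => F _; rewrite up1; ring.
have A6E : A6 = B3 + covers k H E.
  rewrite /A6; under eq_bigr do rewrite -[covers k _ E]mul1r.
  rewrite (exchange_lines _ _ _ (fun=> 1) (fun=> 1)) /B3 -big_split /=.
  by apply: eq_bigr => F _; rewrite up1; ring.
have DE : \sum_(G in flats k.+2 H | (E \subset G) && (i \notin G))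
    (covers k G E - 1) = A6 - N - (covers k H E - 1).
  have F0H := closureU1_flats fH EH iH iE.
  have sEF0 := sub_closureU1 r E i.
  have: \sum_(G in flats k.+2 H | (E \subset G) && (i \in G))
      (covers k G E - 1) = covers k H E - 1.
    rewrite (eq_bigl (fun G => (G \in flats k.+2 H) &&
        (closure (i |: E) \subset G))) => [|G]; last first.
      case GH: (G \in _) => //=; have /flatsP[fG _ _] := GH.
      by rewrite closure_sub_flat // subUset sub1set andbC.
    rewrite sumrB -/(covers _ _ _) [X in X - _](lines (fun=> 1) _ F0H sEF0).
    by rewrite up1; ring.
  rewrite /A6 /N -sumrB => <-.
  rewrite [X in _ = X - _](bigID (fun G => i \in G)) /= addrC.
  under [X in _ = X + _ - _]eq_bigl do rewrite -andbA.
  under [X in _ = _ + X - _]eq_bigl do rewrite -andbA.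
  by ring.
have sq3 : \sum_(G in flats k.+2 H | E \subset G)
    (z G - a - up_sum k G y E) ^+ 2 =
  A1 - 2 * a * A2 + a ^+ 2 * N - 2 * A3 + 2 * a * A4 + 2 * a * A5
  - 2 * a ^+ 2 * A6
  + \sum_(G in flats k.+2 H | E \subset G) up_sum k G y E ^+ 2.
  rewrite /A1 /A2 /A3 /A4 /A5 /A6 /N !mulr_sumr -!(sumrB, big_split) /=.
  by apply: eq_bigr => G _; rewrite upB; ring.
have -> : \sum_(F in flats k.+1 H | E \subset F)
     (2 * z F * up_sum k.+1 H z F - (covers k.+1 H F - 1) * z F ^+ 2) =
  2 * A3 - B1.
  by rewrite -A3E /B1 mulr_sumr -sumrB; apply: eq_bigr => F _; ring.
have -> : \sum_(G in flats k.+2 H | E \subset G) (covers k G E - 1) * z G =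
  A4 - A2 by rewrite /A4 /A2 -sumrB; apply: eq_bigr => G _; ring.
have sqB : \sum_(F in flats k.+1 H | E \subset F)
    (covers k.+1 H F - 1) * (z F - a) ^+ 2 = B1 - 2 * a * B2 + a ^+ 2 * B3.
  rewrite /B1 /B2 /B3 !mulr_sumr -!(sumrB, big_split) /=.
  by apply: eq_bigr => F _; ring.
rewrite DE sq3 sqY sqB upB A5E A6E /lower_row -/A1 -/a; ring.
Qed.


(** The form of level k below G extended to vectors with a coordinate on G
    itself: for any j in G it is the form at z - z G * [j in _], a vector that
    vanishes on G and represents the same class. *)
Definition top_form k G z :=
  form k G z z - 2 * z G * \sum_(E in flats k G) weight E * z E +
  z G ^+ 2 * (\sum_(E in flats k G) weight E - coweight k.+1 G).

Lemma sum_two_steps k H i (f g : {set T} -> R) : flat r H -> i \in H ->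
  \sum_(F in flats k.+1 H | i \notin F)
     (\sum_(E in flats k F) f E) * up_sum k.+1 H g F =
  \sum_(E in flats k H | i \notin E) f E *
     \sum_(G in flats k.+2 H | E \subset G) (covers k G E - 1) * g G +
  \sum_(G in flats k.+2 H | i \notin G) g G * \sum_(E in flats k G) f E.
Proof.
move=> fH iH; have -> : \sum_(F in flats k.+1 H | i \notin F)
    (\sum_(E in flats k F) f E) * up_sum k.+1 H g F =
  \sum_(G in flats k.+2 H) \sum_(F in flats k.+1 G | i \notin F)
     (\sum_(E in flats k F) f E) * g G.
  by rewrite exchange_flats_cond; apply: eq_bigr => F _; rewrite mulr_sumr.
have -> : \sum_(E in flats k H | i \notin E) f E *
     \sum_(G in flats k.+2 H | E \subset G) (covers k G E - 1) * g G =
  \sum_(G in flats k.+2 H) \sum_(E in flats k G | i \notin E)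
     (covers k G E - 1) * f E * g G.
  rewrite exchange_flats_cond; apply: eq_bigr => E _; rewrite mulr_sumr.
  by apply: eq_bigr => G _; ring.
rewrite [X in _ = _ + X]big_mkcondr -big_split /=; apply: eq_bigr => G GH.
have /flatsP[fG _ _] := GH; rewrite -!mulr_suml; case: (boolP (i \in G)) => iG.
  by rewrite addr0 sum_avoiding.
rewrite (mulrC (g G)) -mulrDl; congr (_ * _).
have avoid h E : E \in flats h G -> i \notin E.
  by move=> /flatsP[_ sEG _]; apply: contra iG; apply: subsetP.
rewrite [LHS](eq_bigl (fun F => F \in flats k.+1 G)) => [|F]; last first.
  by case FG: (F \in _) => //=; apply: avoid FG.
rewrite [X in X + _](eq_bigl (fun E => E \in flats k G)) => [|F]; last first.
  by case FG: (F \in _) => //=; apply: avoid FG.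
rewrite exchange_flats -big_split /=; apply: eq_bigr => E _.
rewrite mulrBl mul1r subrK /covers mulr_suml.
by apply: eq_bigr => F _; rewrite mul1r.
Qed.

(** The class beta is the sum of the generators of the flats avoiding i, and for
    k > 0 the form of level k + 1 is the value at x = beta of the trilinear form
    deg(alpha^a beta^(k-1) x y z).  The three sums are the contributions of the
    generators of flats of ranks k, k + 1 and k + 2. *)
Lemma bochner_identity k H i z : flat r H -> i \in H ->
  form k.+1 H z z =
    \sum_(E in flats k H | i \notin E) weight E *
      (lower_row k H z E ^+ 2 - \sum_(G in flats k.+2 H | E \subset G)
         (z G - z E - up_sum k G (fun F => z F - z E) E) ^+ 2) +
    2 * \sum_(F in flats k.+1 H | i \notin F)
          upper_row k z F * lower_row k.+1 H z F +
    \sum_(G in flats k.+2 H | i \notin G) top_form k G z.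
Proof.
move=> fH iH; pose P X := \sum_(E in flats k X) weight E * z E.
pose q F := 2 * z F * up_sum k.+1 H z F - (covers k.+1 H F - 1) * z F ^+ 2.
pose t E := \sum_(G in flats k.+2 H | E \subset G) (covers k G E - 1) * z G.
pose d E := \sum_(G in flats k.+2 H | (E \subset G) && (i \notin G))
  (covers k G E - 1).
(* S1 and S2 rest on Weisner's theorem, in ranks k + 1 and k + 2. *)
have S1 : \sum_(E in flats k H | i \notin E)
      \sum_(F in flats k.+1 H | E \subset F) weight E * q F =
    \sum_(F in flats k.+1 H) weight F * q F +
    \sum_(F in flats k.+1 H | i \notin F) coweight k F * q F.
  rewrite -exchange_flats_cond [X in _ = _ + X]big_mkcondr -big_split /=.
  apply: eq_bigr => F FH; rewrite -mulr_suml (sum_weight_avoiding _ _ FH).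
  by case: (i \in F) => /=; ring.
have S2 : \sum_(E in flats k H | i \notin E)
      \sum_(G in flats k.+2 H | E \subset G) weight E * z G ^+ 2 =
    \sum_(G in flats k.+2 H) coweight k.+1 G * z G ^+ 2 +
    \sum_(G in flats k.+2 H | i \notin G)
      (\sum_(E in flats k G) weight E - coweight k.+1 G) * z G ^+ 2.
  rewrite -exchange_flats_cond [X in _ = _ + X]big_mkcondr -big_split /=.
  apply: eq_bigr => G GH; rewrite -mulr_suml (sum_weight2_avoiding _ _ GH).
  by case: (i \in G) => /=; ring.
have -> : \sum_(E in flats k H | i \notin E) weight E *
      (lower_row k H z E ^+ 2 - \sum_(G in flats k.+2 H | E \subset G)
         (z G - z E - up_sum k G (fun F => z F - z E) E) ^+ 2) =
  \sum_(E in flats k H | i \notin E)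
     \sum_(F in flats k.+1 H | E \subset F) weight E * q F -
  \sum_(E in flats k H | i \notin E)
     \sum_(G in flats k.+2 H | E \subset G) weight E * z G ^+ 2 -
  2 * \sum_(E in flats k H | i \notin E) weight E * z E * t E +
  \sum_(E in flats k H | i \notin E) weight E * z E ^+ 2 * d E.
  rewrite mulr_sumr -!(sumrB, big_split) /=; apply: eq_bigr => E /andP[EH iE].
  by rewrite (rank3_form _ fH EH iH iE) -/(t E) -/(d E) -!mulr_sumr; ring.
have -> : \sum_(F in flats k.+1 H | i \notin F)
    upper_row k z F * lower_row k.+1 H z F =
  \sum_(F in flats k.+1 H | i \notin F) P F * up_sum k.+1 H z F -
  \sum_(F in flats k.+1 H | i \notin F) (covers k.+1 H F - 1) * (P F * z F) -
  \sum_(F in flats k.+1 H | i \notin F) coweight k F * z F * up_sum k.+1 H z F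
  + \sum_(F in flats k.+1 H | i \notin F)
      (covers k.+1 H F - 1) * (coweight k F * z F ^+ 2).
  rewrite -!(sumrB, big_split) /=; apply: eq_bigr => F _.
  by rewrite /upper_row /lower_row -/(P F); ring.
have S3 : \sum_(F in flats k.+1 H | i \notin F) coweight k F * q F =
  2 * \sum_(F in flats k.+1 H | i \notin F)
        coweight k F * z F * up_sum k.+1 H z F
  - \sum_(F in flats k.+1 H | i \notin F)
      (covers k.+1 H F - 1) * (coweight k F * z F ^+ 2).
  by rewrite mulr_sumr -sumrB; apply: eq_bigr => F _; rewrite /q; ring.
have dE : \sum_(E in flats k H | i \notin E) weight E * z E ^+ 2 * d E =
    \sum_(G in flats k.+2 H | i \notin G)
      \sum_(E in flats k G) weight E * z E ^+ 2 * (covers k G E - 1).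
  rewrite [RHS]big_mkcondr /=; transitivity (\sum_(G in flats k.+2 H)
    \sum_(E in flats k G | i \notin E)
      (i \notin G)%:R * (weight E * z E ^+ 2 * (covers k G E - 1))).
    rewrite exchange_flats_cond; apply: eq_bigr => E _; rewrite mulr_sumr.
    rewrite [LHS]big_mkcond [RHS]big_mkcond /=; apply: eq_bigr => G _.
    case: (G \in _); case: (E \subset G); case: (i \in G) => //=; ring.
  apply: eq_bigr => G GH; rewrite -mulr_sumr; case: (boolP (i \in G)) => iG /=.
    by rewrite mul0r.
  rewrite mul1r; apply: eq_bigl => E; case EG: (E \in _) => //=.
  by apply: contra iG; apply: subsetP; case/flatsP: EG.
have topE : \sum_(G in flats k.+2 H | i \notin G) top_form k G z =
    2 * \sum_(F in flats k.+1 H | i \notin F)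
          (covers k.+1 H F - 1) * (P F * z F)
  - \sum_(G in flats k.+2 H | i \notin G)
      \sum_(E in flats k G) weight E * z E ^+ 2 * (covers k G E - 1)
  - \sum_(F in flats k.+1 H | i \notin F)
      (covers k.+1 H F - 1) * (coweight k F * z F ^+ 2)
  - 2 * \sum_(G in flats k.+2 H | i \notin G) z G * P G
  + \sum_(G in flats k.+2 H | i \notin G)
      (\sum_(E in flats k G) weight E - coweight k.+1 G) * z G ^+ 2.
  rewrite -!sum_avoiding // !mulr_sumr -!(sumrB, big_split) /=.
  apply: eq_bigr => G _; rewrite /top_form -/(P G) form_diag.
  have -> : \sum_(F in flats k.+1 G) P F * z F =
      \sum_(E in flats k G) weight E * z E * up_sum k G z E.
    under eq_bigr do rewrite mulr_suml.
    by rewrite exchange_flats; apply: eq_bigr => E _; rewrite mulr_sumr.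
  have -> : \sum_(E in flats k G) weight E *
      (2 * z E * up_sum k G z E - (covers k G E - 1) * z E ^+ 2) =
    2 * \sum_(E in flats k G) weight E * z E * up_sum k G z E -
    \sum_(E in flats k G) weight E * z E ^+ 2 * (covers k G E - 1).
    by rewrite mulr_sumr -sumrB; apply: eq_bigr => E _; ring.
  ring.
have twoE := sum_two_steps k (fun E => weight E * z E) z fH iH.
rewrite form_diag topE dE S1 S2 S3.
have -> : \sum_(F in flats k.+1 H | i \notin F) P F * up_sum k.+1 H z F = _
  := twoE.
rewrite -/(t _); ring.
Qed.

End IntersectionForm.

(** * The Hodge index inequality *)

Section HodgeIndex.
Variables (T : finType) (r : matroid T) (R : realFieldType).
Implicit Types (S X F G H E : {set T}) (i j : T) (k : nat) (z : {set T} -> R).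
Local Notation closure := (closure r).
Local Notation flats := (flats r).
Local Notation weight := (@weight T r R).
Local Notation coweight := (@coweight T r R).
Local Notation covers := (@covers T r R).
Local Notation form := (@form T r R).
Local Notation up_sum := (@up_sum T r R).
Local Notation upper_row := (@upper_row T r R).
Local Notation lower_row := (@lower_row T r R).
Local Notation top_form := (@top_form T r R).

(** For every i in H, the class alpha is the sum of the generators of the flats
    through i, and beta is the sum of those of the flats avoiding i. *)
Definition mem_vec i F : R := (i \in F)%:R.
Definition avoid_vec i F : R := (i \notin F)%:R.

Lemma form_linear k H a z z' y :
  form k H (fun F => z F + a * z' F) y = form k H z y + a * form k H z' y.
Proof.
rewrite /form mulrDr !mulr_sumr addrACA -!big_split /=; congr (_ + _).
  apply: eq_bigr => G _; rewrite /upper_row.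
  under eq_bigr do rewrite mulrDr mulrCA.
  by rewrite big_split -mulr_sumr /=; ring.
apply: eq_bigr => F _; rewrite /lower_row /up_sum big_split -mulr_sumr /=; ring.
Qed.

Lemma form_avoid_vec k H i z : flat r H -> i \in H ->
  form k H (avoid_vec i) z = \sum_(G in flats k.+1 H) weight G * z G.
Proof.
move=> fH iH; rewrite /form [X in _ + X]big1 ?addr0 => [|F FH].
  apply: eq_bigr => G GH; congr (_ * _); rewrite /upper_row /avoid_vec.
  rewrite mulrC; apply/eqP; rewrite subr_eq; apply/eqP.
  rewrite -(sum_weight_avoiding R i GH) [RHS]big_mkcondr /=.
  by apply: eq_bigr => F _; case: (i \in F); rewrite ?mulr0 ?mulr1.
rewrite /lower_row [_ * avoid_vec i F]mulrC -(covers_avoiding R fH FH iH).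
rewrite (_ : up_sum k H (avoid_vec i) F =
    \sum_(G in flats k.+1 H | (F \subset G) && (i \notin G)) 1).
  by rewrite subrr mulr0 mul0r.
rewrite /up_sum [LHS]big_mkcond [RHS]big_mkcond; apply: eq_bigr => G _.
by rewrite /avoid_vec; case: (G \in _); case: (F \subset G); case: (i \in G).
Qed.

Lemma form_mem_vec k H i z : flat r H -> i \in H ->
  form k H (mem_vec i) z = \sum_(F in flats k H) weight F * z F.
Proof.
move=> fH iH; rewrite /form big1 ?add0r => [|G GH].
  apply: eq_bigr => F FH; congr (_ * _).
  rewrite -[RHS]mulr1; congr (_ * _); rewrite /lower_row.
  have -> : up_sum k H (mem_vec i) F = covers k H F -
      \sum_(G in flats k.+1 H | (F \subset G) && (i \notin G)) 1.
    rewrite /up_sum /covers; apply/eqP; rewrite eq_sym subr_eq; apply/eqP.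
    rewrite [LHS]big_mkcond [X in _ = X + _]big_mkcond.
    rewrite [X in _ = _ + X]big_mkcond -big_split /=; apply: eq_bigr => G _.
    rewrite /mem_vec.
    by case: (G \in _); case: (F \subset G); case: (i \in G);
       rewrite ?addr0 ?add0r.
  rewrite covers_avoiding // /mem_vec; case: (i \in F) => /=; ring.
rewrite /upper_row /mem_vec; case: (boolP (i \in G)) => iG.
  rewrite -(coweight_mem R GH iG) big_mkcondr mulr1 /=.
  apply/eqP; rewrite mulf_eq0 subr_eq0; apply/orP; left; apply/eqP.
  by apply: eq_bigr => F _; case: (i \in F); rewrite ?mulr0 ?mulr1.
rewrite mulr0 big1 ?subrr ?mul0r // => F /flatsP[_ sFG _].
by rewrite (contraNF (subsetP sFG i) iG) mulr0.
Qed.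

Lemma sum_mem_vec k H i :
  \sum_(F in flats k H) weight F * mem_vec i F =
  \sum_(F in flats k H | i \in F) weight F.
Proof.
rewrite [RHS]big_mkcondr; apply: eq_bigr => F _; rewrite /mem_vec.
by case: (i \in F); rewrite ?mulr0 ?mulr1.
Qed.

Lemma sum_avoid_vec k H i :
  \sum_(F in flats k H) weight F * avoid_vec i F =
  \sum_(F in flats k H | i \notin F) weight F.
Proof.
rewrite [RHS]big_mkcondr; apply: eq_bigr => F _; rewrite /avoid_vec.
by case: (i \in F); rewrite ?mulr0 ?mulr1.
Qed.

Lemma form_shift k H i a b z : flat r H -> i \in H ->
  form k H (fun F => (z F + a * mem_vec i F) + b * avoid_vec i F)
           (fun F => (z F + a * mem_vec i F) + b * avoid_vec i F) =
  form k H z z + 2 * a * \sum_(F in flats k H) weight F * z F +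
  a ^+ 2 * \sum_(F in flats k H | i \in F) weight F +
  2 * b * (\sum_(G in flats k.+1 H) weight G * z G +
           a * \sum_(G in flats k.+1 H | i \in G) weight G) +
  b ^+ 2 * \sum_(G in flats k.+1 H | i \notin G) weight G.
Proof.
move=> fH iH; set Z := fun F => _.
have sumZ h : \sum_(F in flats h H) weight F * Z F =
    \sum_(F in flats h H) weight F * z F +
    a * \sum_(F in flats h H | i \in F) weight F +
    b * \sum_(F in flats h H | i \notin F) weight F.
  rewrite -sum_mem_vec -sum_avoid_vec !mulr_sumr -!big_split /=.
  by apply: eq_bigr => F _; rewrite /Z; ring.
have formZ y : form k H Z y =
    form k H z y + a * form k H (mem_vec i) y + b * form k H (avoid_vec i) y.
  by rewrite form_linear form_linear.
rewrite formZ form_sym formZ !form_mem_vec // !form_avoid_vec // !sumZ.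
rewrite weisner_shift //; ring.
Qed.

(** By form_avoid_vec the condition on z is orthogonality to beta. *)
Definition hodge_index k := forall H, flat r H -> (k.+2 <= r H)%N -> forall z,
  \sum_(G in flats k.+1 H) weight G * z G = 0 -> form k H z z <= 0.

Hypothesis loopless : closure set0 = set0.

(** This is the reverse Cauchy-Schwarz inequality between z and beta in the
    form below G, for which beta has self-pairing m_G: subtract from z its
    component along beta, the multiple b of avoid_vec j. *)
Lemma top_form_le k H G z : hodge_index k -> G \in flats k.+2 H ->
  weight G * top_form k G z <= upper_row k.+1 z G ^+ 2.
Proof.
move=> hodgek GH; have wG := weight_gt0 R loopless GH.
have /flatsP[fG _ rG] := GH.
have [G0 | [j jG]] := set_0Vmem G; first by rewrite G0 rank_set0 in rG.
pose b := - (upper_row k.+1 z G / weight G).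
have bE : b * weight G = - upper_row k.+1 z G.
  by rewrite mulNr divfK // gt_eqF.
have GG : G \in flats k.+2 G by apply/flatsP.
pose Z F := (z F + - z G * mem_vec j F) + b * avoid_vec j F.
have Z0 : \sum_(F in flats k.+1 G) weight F * Z F = 0.
  have -> : \sum_(F in flats k.+1 G) weight F * Z F =
    \sum_(F in flats k.+1 G) weight F * z F -
    z G * \sum_(F in flats k.+1 G) weight F * mem_vec j F +
    b * \sum_(F in flats k.+1 G) weight F * avoid_vec j F.
    rewrite !mulr_sumr -!(sumrB, big_split) /=.
    by apply: eq_bigr => F _; rewrite /Z; ring.
  rewrite sum_mem_vec sum_avoid_vec (coweight_mem R GG jG) (weisner R GG jG) bE.
  by rewrite /upper_row; ring.
have := hodgek G fG _ Z Z0; rewrite rG leqnn => /(_ isT).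
rewrite form_shift // (coweight_mem R GG jG) (weisner R GG jG).
have -> : \sum_(E in flats k G | j \in E) weight E =
    \sum_(E in flats k G) weight E - coweight k.+1 G.
  rewrite [X in _ = X - _](bigID (fun E => j \in E)) /=.
  by rewrite (sum_weight2_avoiding R j GG) jG mul0r addr0 addrK.
rewrite -(pmulr_rle0 _ wG) -[X in _ -> is_true X]subr_le0.
congr (is_true (_ <= _)).
rewrite /top_form [LHS](_ : _ = weight G * (form k G z z -
  2 * z G * (\sum_(F in flats k G) weight F * z F) + z G ^+ 2 *
  (\sum_(E in flats k G) weight E - coweight k.+1 G)) +
  2 * (b * weight G) * (\sum_(F in flats k.+1 G) weight F * z F - z G *
     coweight k.+1 G) + (b * weight G) ^+ 2); last by ring.
by rewrite bE /upper_row; ring.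
Qed.

Lemma covers_gt1 k H F : flat r H -> F \in flats k H -> (k.+2 <= r H)%N ->
  1 < covers k H F.
Proof.
move=> fH FH ltkH; have /flatsP[fF sFH rF] := FH.
have [i iH iF] : exists2 i, i \in H & i \notin F.
  apply/subsetPn; apply: contraTN ltkH => /(rank_mono r).
  by rewrite rF -ltnNge ltnS; apply: leqW.
have GH := closureU1_flats fH FH iH iF; set G := closure _ in GH.
have [j jH jG] : exists2 j, j \in H & j \notin G.
  apply/subsetPn; apply: contraTN ltkH => /(rank_mono r).
  by have /flatsP[_ _ ->] := GH; rewrite -ltnNge.
have jF : j \notin F.
  by apply: contra jG; apply: subsetP (sub_closureU1 r F i) j.
have := covers_avoiding R fH FH jH; rewrite jF mul1r -subr_gt0 => <-.
by rewrite (bigD1 G) ?GH ?sub_closureU1 //= ltr_pwDl // sumr_ge0.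
Qed.


Section InductionStep.
Variables (k : nat) (H : {set T}).
Hypotheses (fH : flat r H) (rH : (k.+3 <= r H)%N).

(** The coordinates on flats of rank k + 1 that annihilate lower_row; they
    maximize the form among the vectors that agree with w in rank k + 2. *)
Definition fill w F := up_sum k.+1 H w F / (covers k.+1 H F - 1).

Definition reduced w G :=
  \sum_(F in flats k.+1 G) weight F * fill w F - coweight k.+1 G * w G.

Lemma exists_outside_flat h F : F \in flats h H -> (h < r H)%N ->
  exists2 i, i \in H & i \notin F.
Proof.
move=> /flatsP[_ _ rF] lt; apply/subsetPn; apply: contraTN lt.
by move=> /(rank_mono r); rewrite rF -leqNgt.
Qed.

(** The sum of the vectors avoid_vec i over i in H.  Unlike each of them, it is
    strictly positive on the proper flats. *)
Definition outside G : R := #|H :\: G|%:R.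

Lemma outsideE G : outside G = \sum_(i in H) (i \notin G)%:R.
Proof.
rewrite /outside -sum1_card natr_sum big_mkcond [RHS]big_mkcond /=.
apply: eq_bigr => i _; rewrite !inE andbC.
by case: (i \in H); case: (i \in G).
Qed.

(** Extend w to rank k + 1 by fill, and to rank k so that the square in
    rank3_form vanishes; then bound top_form by induction, and sum the Bochner
    identity over all i in H. *)
Lemma reduced_bochner w : hodge_index k ->
  \sum_(G in flats k.+2 H) reduced w G * w G <=
  \sum_(G in flats k.+2 H)
     outside G / (#|H|%:R * weight G) * reduced w G ^+ 2.
Proof.
move=> hodgek.
pose z S := if r S == k.+2 then w S else if r S == k.+1 then fill w S else
  up_sum k H (fill w) S / (covers k H S - 1).
have zG G : G \in flats k.+2 H -> z G = w G.
  by move=> /flatsP[_ _ rG]; rewrite /z rG eqxx.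
have zF X F : F \in flats k.+1 X -> z F = fill w F.
  by move=> /flatsP[_ _ rF]; rewrite /z rF eqSS ltn_eqF // eqxx.
have upz G : G \in flats k.+2 H -> upper_row k.+1 z G = reduced w G.
  move=> GH; rewrite /reduced /upper_row zG //; congr (_ - _).
  by apply: eq_bigr => F /zF->.
have lowF F : F \in flats k.+1 H -> lower_row k.+1 H z F = 0.
  move=> FH; rewrite /lower_row (zF H) // /fill mulrC divfK; last first.
    by rewrite subr_eq0 gt_eqF // covers_gt1.
  by apply/subr0_eq; rewrite subr0 /up_sum -sumrB big1 // => G /andP[/zG-> _];
     rewrite subrr.
have lowE E : E \in flats k H -> lower_row k H z E = 0.
  move=> EH; have /flatsP[_ _ rE] := EH.
  have zE : z E = up_sum k H (fill w) E / (covers k H E - 1).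
    by rewrite /z rE !ltn_eqF.
  rewrite /lower_row zE mulrC divfK; last first.
    by rewrite subr_eq0 gt_eqF // covers_gt1 // ltnW.
  by apply/subr0_eq; rewrite subr0 /up_sum -sumrB big1 // => F /andP[/zF-> _];
     rewrite subrr.
have formz : form k.+1 H z z = \sum_(G in flats k.+2 H) reduced w G * w G.
  rewrite /form [X in _ + X]big1 ?addr0 => [|F FH]; last first.
    by rewrite lowF // mulr0 mul0r.
  by apply: eq_bigr => G GH; rewrite upz // zG.
have le_i i : i \in H -> form k.+1 H z z <=
    \sum_(G in flats k.+2 H | i \notin G) reduced w G ^+ 2 / weight G.
  move=> iH; rewrite (bochner_identity _ _ fH iH) [X in _ + 2 * X + _]big1.
    rewrite mulr0 addr0 -[X in _ <= X]add0r lerD //.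
      apply: sumr_le0 => E /andP[EH iE].
      rewrite lowE // expr0n sub0r pmulr_rle0 ?(weight_gt0 R loopless EH) //.
      by rewrite oppr_le0 sumr_ge0 // => *; apply: sqr_ge0.
    apply: ler_sum => G /andP[GH _]; have wG := weight_gt0 R loopless GH.
    by rewrite ler_pdivlMr // mulrC -upz // (top_form_le _ hodgek GH).
  by move=> F /andP[FH _]; rewrite lowF // mulr0.
have H_gt0 : 0 < #|H|%:R :> R.
  rewrite ltr0n; apply: contraTltn rH; rewrite leqn0 cards_eq0 => /eqP->.
  by rewrite rank_set0.
rewrite -formz -(ler_pM2l H_gt0) mulr_sumr.
have -> : #|H|%:R * form k.+1 H z z = \sum_(i in H) form k.+1 H z z.
  by rewrite sumr_const mulr_natl.
apply: le_trans (ler_sum _ le_i) _.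
rewrite le_eqVlt; apply/orP; left; apply/eqP.
under eq_bigr do rewrite big_mkcondr.
rewrite exchange_big /=; apply: eq_bigr => G GH.
have wG := weight_gt0 R loopless GH.
rewrite outsideE [RHS](_ : _ = (\sum_(i in H) (i \notin G)%:R) *
  (reduced w G ^+ 2 / weight G)); last by field; rewrite !gt_eqF.
rewrite mulr_suml; apply: eq_bigr => i _.
by case: (i \in G); rewrite ?mul0r ?mul1r.
Qed.


Lemma fill_outside F : F \in flats k.+1 H -> fill outside F = outside F.
Proof.
move=> FH; rewrite /fill (_ : up_sum _ _ _ _ = outside F *
  (covers k.+1 H F - 1)).
  by rewrite mulfK // subr_eq0 gt_eqF // covers_gt1.
rewrite /up_sum; under eq_bigr do rewrite outsideE.
rewrite exchange_big outsideE mulr_suml /=; apply: eq_bigr => i iH.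
rewrite -(covers_avoiding R fH FH iH) [RHS]big_mkcond [LHS]big_mkcond /=.
apply: eq_bigr => G _.
by case: (G \in _); case: (F \subset G); case: (i \in G).
Qed.

Lemma reduced_outside G : G \in flats k.+2 H ->
  reduced outside G = #|H|%:R * weight G.
Proof.
move=> GH; have /flatsP[_ sGH _] := GH.
rewrite /reduced (eq_bigr (fun F => \sum_(i in H) weight F * (i \notin F)%:R)).
  rewrite exchange_big outsideE mulr_sumr -sumrB /=.
  rewrite -sum1_card natr_sum mulr_suml; apply: eq_bigr => i _.
  rewrite mul1r sum_avoid_vec (sum_weight_avoiding _ _ GH); ring.
move=> F FG; rewrite fill_outside ?outsideE ?mulr_sumr //.
by rewrite (flats_sub _ _ _ sGH) in FG; case/andP: FG.
Qed.

Definition reduced_mx G G' : R :=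
  \sum_(F in flats k.+1 H | (F \subset G) && (F \subset G'))
     weight F / (covers k.+1 H F - 1) - (G == G')%:R * coweight k.+1 G.

Lemma reduced_mxE w G : G \in flats k.+2 H ->
  \sum_(G' in flats k.+2 H) reduced_mx G G' * w G' = reduced w G.
Proof.
move=> GH; have /flatsP[_ sGH _] := GH.
rewrite /reduced_mx; under eq_bigr do rewrite mulrBl mulr_suml.
rewrite sumrB; congr (_ - _); last first.
  rewrite (bigD1 G) //= eqxx mul1r big1 ?addr0 // => G' /andP[_ /negPf neqG].
  by rewrite eq_sym neqG !mul0r.
rewrite (exchange_big_dep
   (fun F => (F \in flats k.+1 H) && (F \subset G))) /=.
  rewrite (eq_bigl (fun F => F \in flats k.+1 G)) => [|F]; last first.
    by rewrite (flats_sub _ _ _ sGH).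
  apply: eq_bigr => F FG.
  rewrite /fill /up_sum [RHS]mulrCA [RHS]mulrC mulr_sumr.
  rewrite (flats_sub _ _ _ sGH) in FG; case/andP: FG => FH sFG.
  by apply: eq_bigl => G'; rewrite FH sFG.
by move=> G' F _ /andP[-> /andP[->]].
Qed.

(** Move from G towards G': choose a hyperplane F of G containing the
    intersection of G and G', and replace G by the flat spanned by F and an
    element of G' outside G, which meets G' in a larger set. *)
Lemma connected_by_hyperplanes (f : {set T} -> R) :
    (forall F G G', F \in flats k.+1 H -> G \in flats k.+2 H ->
       G' \in flats k.+2 H -> F \subset G -> F \subset G' -> f G = f G') ->
  forall G G', G \in flats k.+2 H -> G' \in flats k.+2 H -> f G = f G'.
Proof.
move=> adj G G'; have [n] := ubnP (#|G'| - #|G :&: G'|)%N.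
elim: n G => // n IHn G le_n GH G'H.
have [-> // | neqG] := eqVneq G G'.
have /flatsP[fG sGH rG] := GH; have /flatsP[fG' sG'H rG'] := G'H.
have [i iG' iG] : exists2 i, i \in G' & i \notin G.
  apply/subsetPn; apply: contra neqG => sG'G.
  by apply/eqP/esym/(flat_eq fG' sG'G); rewrite rG rG'.
have [j jG jG'] : exists2 j, j \in G & j \notin G'.
  apply/subsetPn; apply: contra neqG => sGG'.
  by apply/eqP/(flat_eq fG sGG'); rewrite rG rG'.
have jGG' : j \notin G :&: G' by rewrite inE jG.
have [h [F [FG]]] := cover_avoiding (flatI fG fG') fG (subsetIl G G') jG jGG'.
rewrite rG => -[eh] sIF jF; rewrite -{h}eh in FG.
have FH : F \in flats k.+1 H.
  by rewrite (flats_sub _ _ _ sGH) in FG; case/andP: FG.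
have sFG : F \subset G by case/flatsP: FG.
have iF : i \notin F by apply: contra iG; apply: subsetP.
have iH : i \in H by apply: subsetP iG'.
have G1H := closureU1_flats fH FH iH iF; set G1 := closure _ in G1H.
rewrite (adj F G G1) ?sub_closureU1 //; apply: IHn => //.
rewrite ltnS in le_n; apply: leq_trans le_n.
have lt : (#|G :&: G'| < #|G1 :&: G'|)%N.
  apply: proper_card; apply/properP; split.
    by rewrite subsetI subsetIr andbT (subset_trans sIF) ?sub_closureU1.
  by exists i; [rewrite in_setI mem_closureU1 | rewrite in_setI (negPf iG)].
by rewrite ltn_sub2l // (leq_trans lt) // subset_leq_card // subsetIr.
Qed.

Lemma reduced_mx_sym G G' : reduced_mx G G' = reduced_mx G' G.
Proof.
rewrite /reduced_mx [G' == G]eq_sym; have [->//|_] := eqVneq G G'.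
rewrite !mul0r; congr (_ - _); apply: eq_bigl => F.
by rewrite (andbC (F \subset G)).
Qed.

Lemma reduced_term_gt0 F : F \in flats k.+1 H ->
  0 < weight F / (covers k.+1 H F - 1).
Proof.
move=> FH; rewrite divr_gt0 ?(weight_gt0 R loopless FH) //.
by rewrite subr_gt0 covers_gt1.
Qed.

Lemma reduced_mx_ge0 G G' : G != G' -> 0 <= reduced_mx G G'.
Proof.
move=> /negPf neqG; rewrite /reduced_mx neqG mul0r subr0.
by apply: sumr_ge0 => F /andP[FH _]; apply/ltW/reduced_term_gt0.
Qed.

Lemma reduced_mx_gt0 F G G' : F \in flats k.+1 H -> F \subset G ->
  F \subset G' -> G != G' -> 0 < reduced_mx G G'.
Proof.
move=> FH sFG sFG' /negPf neqG; rewrite /reduced_mx neqG mul0r subr0.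
rewrite (bigD1 F) ?FH ?sFG //= ltr_pwDl ?reduced_term_gt0 //.
by apply: sumr_ge0 => E /andP[/andP[EH _] _]; apply/ltW/reduced_term_gt0.
Qed.

Lemma outside_gt0 G : G \in flats k.+2 H -> 0 < outside G.
Proof.
move=> GH; have [i iH iG] := exists_outside_flat GH rH.
by rewrite ltr0n card_gt0; apply/set0Pn; exists i; rewrite inE iG.
Qed.

Lemma reduced_nonpos w : hodge_index k ->
  \sum_(G in flats k.+2 H) weight G * w G = 0 ->
  \sum_(G in flats k.+2 H) reduced w G * w G <= 0.
Proof.
move=> hodgek w0; set A := flats k.+2 H; pose g (p : 'I_#|A|) := enum_val p.
have gA p : g p \in A by apply: enum_valP.
have g_inj : injective g by apply: enum_val_inj.
have H_gt0 : 0 < #|H|%:R :> R.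
  rewrite ltr0n; apply: contraTltn rH; rewrite leqn0 cards_eq0 => /eqP->.
  by rewrite rank_set0.
have w_gt0 p : 0 < weight (g p) by apply: (weight_gt0 R loopless (gA p)).
pose ext (v : 'I_#|A| -> R) G := \sum_(p | g p == G) v p.
have extE v p : ext v (g p) = v p.
  by apply: big_pred1 => q; rewrite /= (inj_eq g_inj).
have sumA (f : {set T} -> R) : \sum_(G in A) f G = \sum_p f (g p).
  exact: big_enum_val.
have mxE v p : \sum_q reduced_mx (g p) (g q) * v (g q) = reduced v (g p).
  by rewrite -reduced_mxE ?gA // sumA.
rewrite sumA; under eq_bigr do rewrite -mxE.
apply: (@nonpos_on_orthogonal R _ (fun p q => reduced_mx (g p) (g q))
  (fun p => outside (g p)) (fun p => #|H|%:R * weight (g p))).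
- by move=> p q; apply: reduced_mx_sym.
- by move=> p q neq_pq; apply: reduced_mx_ge0; rewrite (inj_eq g_inj).
- by move=> p; apply: outside_gt0.
- by move=> p; rewrite mulr_gt0.
- by move=> p; rewrite mxE reduced_outside.
- move=> f adj p q; rewrite -(extE f p) -(extE f q).
  apply: connected_by_hyperplanes (gA p) (gA q) => F G G' FH GH G'H sFG sFG'.
  have [-> // | neqG] := eqVneq G G'.
  have gP X : X \in A -> exists s, X = g s.
    by move=> XA; exists (enum_rank_in XA X); rewrite /g enum_rankK_in.
  have [[s sE] [t tE]] := (gP G GH, gP G' G'H).
  rewrite sE tE !extE; apply: adj; rewrite -?sE -?tE.
    by rewrite -(inj_eq g_inj) -sE -tE.
  exact: reduced_mx_gt0 FH sFG sFG' neqG.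
- move=> v; have Mv p :
      \sum_q reduced_mx (g p) (g q) * v q = reduced (ext v) (g p).
    by rewrite -mxE; apply: eq_bigr => q _; rewrite extE.
  have := reduced_bochner (ext v) hodgek; rewrite !sumA.
  under eq_bigr do rewrite extE -Mv.
  by under [X in _ <= X]eq_bigr do rewrite -Mv.
under eq_bigr do rewrite -mulrA.
by rewrite -mulr_sumr -(sumA (fun G => weight G * w G)) w0 mulr0.
Qed.

Lemma form_le_reduced z :
  form k.+1 H z z <= \sum_(G in flats k.+2 H) reduced z G * z G.
Proof.
have -> : \sum_(G in flats k.+2 H) reduced z G * z G =
    \sum_(F in flats k.+1 H) weight F * fill z F * up_sum k.+1 H z F -
    \sum_(G in flats k.+2 H) coweight k.+1 G * z G ^+ 2.
  rewrite /reduced; under eq_bigr do rewrite mulrBl mulr_suml.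
  rewrite sumrB exchange_flats; congr (_ - _); apply: eq_bigr => F _.
    by rewrite -mulr_sumr.
  by rewrite expr2 mulrA.
rewrite form_diag lerD2r; apply: ler_sum => F FH.
rewrite -[X in _ <= X]mulrA ler_pM2l ?(weight_gt0 R loopless FH) // /fill.
have c_gt0 : 0 < covers k.+1 H F - 1 by rewrite subr_gt0 covers_gt1.
rewrite -(ler_pM2l c_gt0) -subr_ge0.
rewrite [X in 0 <= X](_ : _ =
  (up_sum k.+1 H z F - (covers k.+1 H F - 1) * z F) ^+ 2) ?sqr_ge0 //.
by field; rewrite gt_eqF.
Qed.

End InductionStep.


(** The induction starts at k = 0, where on the orthogonal complement of beta
    the form only retains a nonpositive multiple of the square of the coordinate
    of the empty flat. *)
Theorem hodge_index_holds k : hodge_index k.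
Proof.
elim: k => [|k hodgek] H fH rH z z0; last first.
  exact: le_trans (form_le_reduced fH rH z) (reduced_nonpos fH rH hodgek z0).
have w1 G : G \in flats 1 H -> weight G = 1.
  move=> GH; have /flatsP[_ _ rG] := GH.
  have [G0 | [i iG]] := set_0Vmem G; first by rewrite G0 rank_set0 in rG.
  rewrite -(weisner R GH iG) (flats0 loopless) big_mkcondr big_set1 inE /=.
  exact: weight_set0.
have up0 : up_sum 0 H z set0 = 0.
  rewrite -[RHS]z0; apply: eq_big => [G | G /andP[/w1-> _]].
    by rewrite sub0set andbT.
  by rewrite mul1r.
rewrite form_diag (flats0 loopless) big_set1 up0 mulr0 sub0r.
rewrite [X in _ - X]big1 => [|G GH].
  have S0 : set0 \in flats 0 H by rewrite (flats0 loopless) set11.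
  rewrite subr0 (weight_set0 R loopless) mul1r oppr_le0 mulr_ge0 ?sqr_ge0 //.
  by rewrite subr_ge0 ltW // covers_gt1.
by rewrite /coweight (flats0 loopless) big_set1 (weight_set0 R loopless) w1 //
   subrr mul0r.
Qed.

Definition whitney k H : R := \sum_(F in flats k H) weight F.

(** For k > 0 and i in H these are the absolute values of the coefficients of
    the reduced characteristic polynomial of the interval below H. *)
Definition whitney_through i k H : R :=
  \sum_(F in flats k H | i \in F) weight F.

Lemma flats_gt_rank k H : (r H < k)%N -> flats k H = set0.
Proof.
move=> lt; apply/setP => F; rewrite [RHS]inE; apply/negP => /flatsP[_ sFH rF].
by have := rank_mono r sFH; rewrite rF leqNgt lt.
Qed.

Lemma flats_neq0 k H : flat r H -> (k <= r H)%N -> exists F, F \in flats k H.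
Proof.
move=> fH; elim: k => [|k IHk] lek.
  by exists set0; rewrite (flats0 loopless) set11.
have [F FH] := IHk (ltnW lek); have [i iH iF] := exists_outside_flat FH lek.
by exists (closure (i |: F)); apply: closureU1_flats.
Qed.

Lemma whitney_gt0 k H : flat r H -> (k <= r H)%N -> 0 < whitney k H.
Proof.
move=> fH /(flats_neq0 fH)[F FH]; rewrite /whitney (bigD1 F) //=.
rewrite ltr_pwDl ?(weight_gt0 R loopless FH) // sumr_ge0 // => E /andP[EH _].
exact/ltW/(weight_gt0 R loopless EH).
Qed.

Lemma whitney_through_ge0 i k H : 0 <= whitney_through i k H.
Proof.
by apply: sumr_ge0 => F /andP[FH _]; apply/ltW/(weight_gt0 R loopless FH).
Qed.

Lemma whitney_through_gt0 i k H : flat r H -> i \in H -> (k < r H)%N ->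
  0 < whitney_through i k.+1 H.
Proof.
move=> fH iH ltk; have i0 : i \notin set0 by rewrite inE.
have [h [K [KH]]] := cover_avoiding (flat_set0 loopless) fH (sub0set H) iH i0.
move=> rH _ iK; have /flatsP[fK sKH rK] := KH.
have [|F FK] := @flats_neq0 k K fK; first by rewrite rK -ltnS -rH.
have FH : F \in flats k H.
  by rewrite (flats_sub _ _ _ sKH) in FK; case/andP: FK.
have iF : i \notin F by apply: contra iK; apply: subsetP; case/flatsP: FK.
rewrite /whitney_through -weisner_shift // (bigD1 F) ?FH //=.
rewrite ltr_pwDl ?(weight_gt0 R loopless FH) //.
rewrite sumr_ge0 // => E /andP[/andP[EH _] _].
exact/ltW/(weight_gt0 R loopless EH).
Qed.

(** With s_j for whitney_through i j H, evaluate the form at the combination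
    s_(k+2) alpha - s_(k+1) beta, which is orthogonal to beta. *)
Lemma whitney_through_log_concave i k H : flat r H -> i \in H ->
  whitney_through i k H * whitney_through i k.+2 H <=
  whitney_through i k.+1 H ^+ 2.
Proof.
move=> fH iH; have := whitney_through_ge0 i k.+2 H.
rewrite le_eqVlt => /orP[/eqP<-|c_gt0]; first by rewrite mulr0 sqr_ge0.
have rH : (k.+2 <= r H)%N.
  rewrite leqNgt; apply: contraTN c_gt0 => lt.
  rewrite /whitney_through flats_gt_rank // big_pred0 ?ltxx // => F.
  by rewrite inE.
set b := whitney_through i k.+1 H; set c := whitney_through i k.+2 H in c_gt0 *.
pose Z (F : {set T}) := (0 + c * mem_vec i F) + - b * avoid_vec i F.
have shift h :
    \sum_(F in flats h H | i \notin F) weight F = whitney_through i h.+1 H.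
  exact: weisner_shift.
have /(hodge_index_holds fH rH) : \sum_(G in flats k.+1 H) weight G * Z G = 0.
  rewrite (eq_bigr (fun G => c * (weight G * mem_vec i G) -
    b * (weight G * avoid_vec i G))); last by move=> G _; rewrite /Z; ring.
  by rewrite sumrB -!mulr_sumr sum_mem_vec sum_avoid_vec shift mulrC subrr.
have form0 : form k H (fun=> 0) (fun=> 0) = 0.
  rewrite form_diag !big1 ?subrr // => F _; first by rewrite expr0n mulr0.
  by rewrite mulr0 mul0r expr0n mulr0 subr0 mulr0.
have sum0 h : \sum_(F in flats h H) weight F * 0 = 0.
  by apply: big1 => F _; rewrite mulr0.
rewrite (form_shift k c (- b) (fun=> 0) fH iH) form0 !sum0 shift.
rewrite -/(whitney_through i k H) -/b -/(whitney_through i k.+1 H) -/b -/c.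
move=> le0.
rewrite -subr_le0 -(pmulr_rle0 _ c_gt0); apply: le_trans le0.
by rewrite le_eqVlt; apply/orP; left; apply/eqP; ring.
Qed.

Lemma whitneyE i k H : flat r H -> i \in H ->
  whitney k H = whitney_through i k H + whitney_through i k.+1 H.
Proof.
move=> fH iH; rewrite /whitney (bigID (fun F => i \in F)) /=.
by congr (_ + _); apply: weisner_shift.
Qed.

(** The sums of two consecutive terms of a positive log-concave sequence form a
    log-concave sequence, and whitneyE presents the Whitney numbers so. *)
Theorem whitney_log_concave k H : flat r H ->
  whitney k H * whitney k.+2 H <= whitney k.+1 H ^+ 2.
Proof.
move=> fH; have [lt | le] := ltnP (r H) k.+2.
  rewrite [whitney k.+2 H]big_pred0 ?mulr0 ?sqr_ge0 // => F.
  by rewrite flats_gt_rank // inE.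
have [i iH] : exists i, i \in H.
  apply/set0Pn; apply: contraTneq le => ->; by rewrite rank_set0.
have b_gt0 := whitney_through_gt0 fH iH (ltn_trans (ltnSn k) le).
have c_gt0 := whitney_through_gt0 fH iH le.
have := whitney_through_ge0 i k H; have := whitney_through_ge0 i k.+3 H.
have := whitney_through_log_concave k fH iH.
have := whitney_through_log_concave k.+1 fH iH.
rewrite !(whitneyE _ fH iH); move: b_gt0 c_gt0.
move: (whitney_through i k H) (whitney_through i k.+1 H)
  (whitney_through i k.+2 H) (whitney_through i k.+3 H).
move=> a b c d b_gt0 c_gt0 bd ac d_ge0 a_ge0.
have ad : a * d <= b * c.
  rewrite -(ler_pM2l (mulr_gt0 b_gt0 c_gt0)).
  rewrite [X in X <= _](_ : _ = (a * c) * (b * d)); last by ring.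
  rewrite [X in _ <= X](_ : _ = b ^+ 2 * c ^+ 2); last by ring.
  by rewrite ler_pM // mulr_ge0 // ltW.
rewrite (_ : (a + b) * (c + d) = a * c + a * d + b * c + b * d); last by ring.
rewrite (_ : (b + c) ^+ 2 = b ^+ 2 + b * c + b * c + c ^+ 2); last by ring.
by rewrite !lerD.
Qed.

(** Group the sets S by closure. *)
Lemma sum_rank_whitney k :
  \sum_(S | r S == k) (-1) ^+ #|S| = (-1) ^+ k * whitney k setT.
Proof.
rewrite (partition_big closure (fun F => F \in flats k setT)) => [|S /eqP rS].
  rewrite /whitney mulr_sumr; apply: eq_bigr => F /flatsP[_ _ rF].
  rewrite /weight mulr_sumr; apply: eq_big => [S | S _].
    case: (closure S =P F) => [eF | _]; rewrite ?andbF // andbT.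
    by rewrite -(rank_closure r S) eF rF eqxx.
  by rewrite rF addnC exprD signrMK.
by apply/flatsP; rewrite flat_closure subsetT rank_closure.
Qed.

End HodgeIndex.

(** * Unimodality, cycle matroids and chromatic polynomials *)

(** Positivity and log-concavity make the ratios of consecutive terms decrease,
    so once the sequence has started to decrease it never increases again; the
    absence of internal zeros is what keeps a zero term from interrupting this
    argument. *)
Lemma log_concave_unimodal (R : realDomainType) m (a : nat -> R) :
    (forall i, 0 <= a i) -> log_concave m a -> no_internal_zeros m a ->
  unimodal m a.
Proof.
move=> a_ge0 lc nz; pose stop i := (i == m) || (a i.+1 < a i).
have ex : exists i, stop i by exists m; rewrite /stop eqxx.
case: (ex_minnP ex) => i stop_i min_i; exists i; split.
- by apply: min_i; rewrite /stop eqxx.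
- move=> j ltji; rewrite leNgt; apply/negP => lt_a.
  by have := min_i j; rewrite /stop lt_a orbT leqNgt ltji => /(_ isT).
move=> j leij ltjm; elim: j leij ltjm => [|j IHj] leij ltjm.
  move: leij stop_i ltjm; rewrite leqn0 /stop => /eqP-> /orP[/eqP<-|/ltW //].
  by rewrite ltnn.
move: leij; rewrite leq_eqVlt => /orP[/eqP ei | leij].
  by move: stop_i; rewrite /stop ei => /orP[/eqP em | /ltW //];
     rewrite em ltnn in ltjm.
have le1 := IHj leij (ltnW ltjm).
have := lc j.+1 isT ltjm; rewrite /= => lcj.
have := a_ge0 j; rewrite le_eqVlt => /orP[/eqP aj0 | aj_gt0]; last first.
  rewrite -(ler_pM2l aj_gt0); apply: le_trans lcj _.
  by rewrite expr2 ler_wpM2r.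
have aj1 : a j.+1 = 0 by apply/eqP; rewrite eq_le a_ge0 aj0 le1.
rewrite aj1; have [->//|aj2] := eqVneq (a j.+2) 0; case: nz.
have lt_a : a i.+1 < a i.
  move: stop_i => /orP[/eqP em|//]; move: ltjm.
  by rewrite -em ltnNge (ltnW leij).
exists i, j.+1, j.+2; split; split=> //.
by rewrite gt_eqF // (le_lt_trans _ lt_a).
Qed.

Section VectorMatroid.
Variables (K : fieldType) (n : nat) (T : finType) (v : T -> 'rV[K]_n).
Implicit Types (S : {set T}) (i j : T).

Definition span S := (\sum_(i in S) <<v i>>)%MS.

Lemma span_subP m S (U : 'M_(m, n)) :
  reflect (forall i, i \in S -> (v i <= U)%MS) (span S <= U)%MS.
Proof.
by apply: (iffP sumsmx_subP) => sU i /sU; rewrite genmxE.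
Qed.

Lemma mem_span S i : i \in S -> (v i <= span S)%MS.
Proof. by move: i; apply/span_subP. Qed.

Lemma spanU1 S i : (span (i |: S) :=: v i + span S)%MS.
Proof.
apply/eqmxP/andP; split.
  apply/span_subP => j /setU1P[-> | jS]; first exact: addsmxSl.
  exact: submx_trans (mem_span jS) (addsmxSr _ _).
rewrite addsmx_sub mem_span ?setU11 //.
by apply/span_subP => j jS; apply: mem_span; rewrite setU1r.
Qed.

Lemma rank_spanU1 S i :
  (\rank (span (i |: S)) == \rank (span S)) = (v i <= span S)%MS.
Proof.
rewrite spanU1 eq_sym (mxrank_leqif_sup (addsmxSr (v i) (span S))).
by rewrite addsmx_sub submx_refl andbT.
Qed.

Lemma vector_rank0 : \rank (span set0) = 0%N.
Proof. by rewrite /span big_set0 mxrank0. Qed.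

Lemma vector_rank_setU1 S i :
  (\rank (span S) <= \rank (span (i |: S)) <= (\rank (span S)).+1)%N.
Proof.
rewrite !spanU1 mxrankS ?addsmxSr //=.
apply: leq_trans (mxrank_adds_leqif _ _) _.
exact: leq_add (rank_leq_row (v i)) (leqnn _).
Qed.

Lemma vector_rank_parallel S i j :
  \rank (span (i |: S)) = \rank (span S) ->
  \rank (span (j |: S)) = \rank (span S) ->
  \rank (span (i |: (j |: S))) = \rank (span S).
Proof.
move=> /eqP; rewrite rank_spanU1 => iS eqj; rewrite -[RHS]eqj; apply/eqP.
rewrite rank_spanU1 spanU1; apply: submx_trans iS _; exact: addsmxSr.
Qed.

Definition vector_matroid :=
  Matroid vector_rank0 vector_rank_setU1 vector_rank_parallel.

End VectorMatroid.

(** Each of the m rows ranges over the kernel of A^T, of dimension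
    n - rank A. *)
Lemma card_row_orthogonal (F : finFieldType) m n p (A : 'M[F]_(p, n)) :
  #|[set X : 'M[F]_(m, n) | X *m A^T == 0]| = (#|F| ^ (m * (n - \rank A)))%N.
Proof.
rewrite -mxrank_tr -mxrank_ker -card_mx.
set B := row_base (kermx A^T).
rewrite -cardsT -(card_imset _ (f := fun Y : 'M_(m, _) => Y *m B)).
  congr #|pred_of_set _|; apply/setP => X; rewrite inE.
  apply/eqP/imsetP => [/sub_kermxP | [Y _ ->]].
    by rewrite -(eq_row_base (kermx A^T)) => /submxP[Y ->]; exists Y.
  by apply/sub_kermxP; rewrite -(eq_row_base (kermx A^T)) submxMl.
by move=> Y Y'; apply: row_free_inj; apply: row_base_free.
Qed.

Section GraphMatroid.
Variable G : graph.

Definition vertex_vec (x : vertex G) : 'rV['F_2]_#|vertex G| :=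
  delta_mx 0 (enum_rank x).

(** Over the field with two elements, a coloring by 2^k colors is a k-tuple of
    vectors, and being constant along a set of edges is a linear condition.
    That counts such colorings by linear algebra. *)
Definition edge_vec (e : edge G) :=
  vertex_vec (ends e).1 - vertex_vec (ends e).2.

Definition cycle_matroid := vector_matroid edge_vec.

Definition mono (t : nat) (f : {ffun vertex G -> 'I_t}) (e : edge G) :=
  f (ends e).1 == f (ends e).2.

(** Identify the colors with the column vectors of length k: a coloring becomes
    a matrix, and it is constant along S if and only if its rows are orthogonal
    to the edge vectors of S. *)
Lemma card_mono_on k (S : {set edge G}) :
  #|[set f : {ffun vertex G -> 'I_(2 ^ k)} | [forall e in S, mono f e]]| =
  ((2 ^ k) ^ (#|vertex G| - cycle_matroid S))%N.
Proof.
have cardC : #|'cV['F_2]_k| = (2 ^ k)%N by rewrite card_mx card_Fp // muln1.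
pose col (x : 'I_(2 ^ k)) : 'cV['F_2]_k := enum_val (cast_ord (esym cardC) x).
have col_inj : injective col by move=> x y /enum_val_inj/cast_ord_inj.
pose X (f : {ffun vertex G -> 'I_(2 ^ k)}) : 'M['F_2]_(k, #|vertex G|) :=
  \matrix_(p, q) col (f (enum_val q)) p 0.
have X_inj : injective X.
  move=> f g /matrixP eX; apply/ffunP => x; apply/col_inj/colP => p.
  by have := eX p (enum_rank x); rewrite !mxE enum_rankK.
have X_bij : bijective X.
  apply: inj_card_bij X_inj _.
  by rewrite card_mx card_Fp // card_ffun card_ord -expnM.
have XE f e : (X f *m (edge_vec e)^T == 0) = mono f e.
  have -> : X f *m (edge_vec e)^T =
      col (f (ends e).1) - col (f (ends e).2).
    rewrite /edge_vec linearB /= mulmxBr /vertex_vec !trmx_delta -!colE.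
    by apply/colP => p; rewrite !mxE !enum_rankK.
  by rewrite subr_eq0 (inj_eq col_inj).
rewrite -expnM -[in RHS](card_Fp (isT : prime 2)).
rewrite -(card_row_orthogonal k (span edge_vec S)).
rewrite -(on_card_preimset (onW_bij _ X_bij)).
congr #|pred_of_set _|; apply/setP => f; rewrite !inE.
apply/forall_inP/eqP => [ok | X0 e eS].
  apply: trmx_inj; rewrite trmx_mul trmxK trmx0.
  apply/sub_kermxP/span_subP => e eS.
  apply/sub_kermxP/trmx_inj; rewrite trmx_mul trmxK trmx0; apply/eqP.
  by rewrite XE ok.
rewrite -XE; apply/eqP/trmx_inj; rewrite trmx_mul trmxK trmx0.
apply/sub_kermxP/(submx_trans (mem_span _ eS))/sub_kermxP/trmx_inj.
by rewrite trmx_mul trmxK trmx0.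
Qed.

Lemma proper_mono t (f : {ffun vertex G -> 'I_t}) :
  Defs.proper f = [forall e, ~~ mono f e].
Proof.
apply/forallP/forallP => [ok e | ok x].
  have /forallP/(_ (ends e).2)/implyP := ok (ends e).1; apply.
  by apply/existsP; exists e; rewrite -surjective_pairing eqxx.
apply/forallP => y; apply/implyP => /existsP[e /orP[] /eqP De].
  by have := ok e; rewrite /mono De.
by have := ok e; rewrite /mono De eq_sym.
Qed.

(** Inclusion-exclusion over the set S of monochromatic edges. *)
Lemma card_proper t : #|@proper_colorings G t|%:R =
  \sum_(S : {set edge G}) (-1) ^+ #|S| *
     #|[set f : {ffun vertex G -> 'I_t} | [forall e in S, mono f e]]|%:R
  :> int.
Proof.
have card_sum (P : pred {ffun vertex G -> 'I_t}) :
    #|[set f | P f]|%:R = \sum_f (P f)%:R :> int.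
  rewrite -sum1_card natr_sum big_mkcond /=.
  by apply: eq_bigr => f _; rewrite inE; case: (P f).
under [RHS]eq_bigr do rewrite card_sum mulr_sumr.
rewrite exchange_big card_sum /=; apply: eq_bigr => f _.
transitivity (\prod_e (- (mono f e)%:R + 1) : int).
  rewrite proper_mono; case: (boolP [forall e, _]) => [/forallP ok | ].
    by rewrite big1 // => e _; rewrite (negPf (ok e)) oppr0 add0r.
  rewrite negb_forall => /existsP[e]; rewrite negbK => me.
  by rewrite (bigD1 e) //= me addNr mul0r.
rewrite bigA_distr; apply: eq_bigr => S _.
rewrite big_if /= [X in _ * X]big1 // mulr1 prodrN; congr (_ * _).
case: (boolP [forall e in S, _]) => [/forall_inP ok | ].
  by rewrite big1 // => e /ok ->.
rewrite negb_forall_in => /exists_inP[e eS /negPf me].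
by rewrite (bigD1 e) //= me mul0r.
Qed.


Definition whitney_poly : {poly int} :=
  \sum_(S : {set edge G}) (-1) ^+ #|S| *: 'X^(#|vertex G| - cycle_matroid S).

(** Powers of 2 are infinitely many points of evaluation. *)
Lemma chromatic_polyE : chromatic_poly G = whitney_poly.
Proof.
set p := chromatic_poly G; apply/eqP; rewrite -subr_eq0; apply/negPn/negP=> nz.
pose s : seq int := [seq (2 ^ i)%:R | i <- iota 0 (size (p - whitney_poly))].
have := @max_poly_roots _ (p - whitney_poly) s nz.
rewrite size_map size_iota ltnn => absurd; apply/notF/absurd.
  apply/allP=> _ /mapP[i _ ->]; rewrite rootE hornerD hornerN.
  rewrite chromatic_polyP ?expn_gt0 // card_proper horner_sum subr_eq0.
  apply/eqP/eq_bigr => S _.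
  by rewrite card_mono_on hornerZ hornerXn -natrX.
rewrite map_inj_uniq ?iota_uniq // => i j /eqP.
by rewrite eqr_nat eqn_exp2l // => /eqP.
Qed.

Lemma coef_chromatic i : (i <= #|vertex G|)%N ->
  ((chromatic_poly G)`_i)%:~R =
    (-1) ^+ (#|vertex G| - i) *
    whitney cycle_matroid rat (#|vertex G| - i) setT.
Proof.
move=> le_i; rewrite -sum_rank_whitney chromatic_polyE coef_sum raddf_sum.
rewrite [RHS]big_mkcond; apply: eq_bigr => S _; rewrite coefZ coefXn.
have le_r : (cycle_matroid S <= #|vertex G|)%N by apply: rank_leq_col.
rewrite (_ : (i == _) = (cycle_matroid S == #|vertex G| - i)%N).
  by case: (_ == _); rewrite /= ?mulr0 // mulr1 rmorph_sign.
by apply/eqP/eqP => ->; rewrite subKn.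
Qed.

Lemma coef_chromatic_gt i : (#|vertex G| < i)%N -> (chromatic_poly G)`_i = 0.
Proof.
move=> lt_i; rewrite chromatic_polyE coef_sum big1 // => S _.
rewrite coefZ coefXn gtn_eqF ?mulr0 //.
by apply: leq_ltn_trans lt_i; apply: leq_subr.
Qed.

Lemma loop_chromatic0 (e : edge G) :
  (ends e).1 = (ends e).2 -> chromatic_poly G = 0.
Proof.
move=> loop; apply: (@chromatic_poly_unique G) (chromatic_polyP G) _ => t _.
rewrite horner0 (_ : proper_colorings _ _ = set0) ?cards0 //.
apply/setP => f; rewrite !inE proper_mono; apply/negbTE.
by rewrite negb_forall; apply/existsP; exists e; rewrite /mono loop eqxx.
Qed.

Lemma closure_set0 : (forall e : edge G, (ends e).1 != (ends e).2) ->
  closure cycle_matroid set0 = set0.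
Proof.
move=> noloop; apply/setP => e; rewrite [RHS]inE; apply/negbTE.
rewrite inE /= rank_spanU1 /span big_set0 submx0 subr_eq0.
apply: contra (noloop e) => /eqP/matrixP/(_ 0 (enum_rank (ends e).1)).
rewrite !mxE !eqxx /=; case: eqP => [/enum_rank_inj-> // | _].
by move/eqP; rewrite oner_eq0.
Qed.

End GraphMatroid.

Theorem corollary1p3 (G : graph) :
  let p := chromatic_poly G in
  let m := degree p in
  [/\ log_concave m (fun i : nat => p`_i),
      no_internal_zeros m (fun i : nat => p`_i) &
      unimodal m (fun i : nat => `|p`_i|)].
Proof.
move=> p m; have [/existsP[e /eqP loop] | ] :=
    boolP [exists e : edge G, (ends e).1 == (ends e).2].
  have p0 : p = 0 by apply: loop_chromatic0 loop.
  have m0 : m = 0%N by rewrite /m /degree p0 size_poly0.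
  split; first by move=> i; rewrite m0 ltn0.
    by move=> [i [j [l [_ [_ _]]]]]; rewrite p0 coef0 eqxx.
  by exists 0%N; rewrite m0; split.
rewrite negb_exists => /forallP noloop.
have loopless := closure_set0 noloop.
set r := cycle_matroid G in loopless; set n := #|vertex G|.
pose W k := whitney r rat k setT.
have fT := flatT r.
have W_gt0 k : (k <= r setT)%N -> 0 < W k by apply: whitney_gt0.
have W0 k : (r setT < k)%N -> W k = 0.
  by move=> lt; apply: big_pred0 => F; rewrite flats_gt_rank // inE.
have W_ge0 k : 0 <= W k.
  by case: (leqP k (r setT)) => [/W_gt0/ltW | /W0->].
have coefE i : (i <= n)%N -> (p`_i)%:~R = (-1) ^+ (n - i) * W (n - i)%N.
  exact: coef_chromatic.
have pn : p`_n != 0.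
  by rewrite -(intr_eq0 rat) coefE // subnn mul1r gt_eqF // W_gt0.
have mE : m = n.
  have size_gt : (n < size p)%N.
    by rewrite ltnNge; apply: contra pn => /leq_sizeP->.
  have size_le : (size p <= n.+1)%N.
    by apply/leq_sizeP => i; apply: coef_chromatic_gt.
  rewrite /m /degree; apply/eqP; rewrite -eqSS prednK ?eqn_leq ?size_le //.
  exact: leq_ltn_trans size_gt.
have lc_W i : (1 <= i)%N -> (i < n)%N ->
    W (n - i.-1)%N * W (n - i.+1)%N <= W (n - i)%N ^+ 2.
  case: i => // i _ lt_i.
  have := whitney_log_concave rat loopless (n - i.+2) fT.
  by rewrite (subnSK lt_i) (subnSK (ltnW lt_i)) mulrC.
have nzp : no_internal_zeros m (fun i : nat => p`_i).
  rewrite mE => -[i [j [l [[ltij ltjl leln] [pi pj _]]]]].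
  have lejn : (j <= n)%N by rewrite (leq_trans (ltnW ltjl)).
  have lein : (i <= n)%N by rewrite (leq_trans (ltnW ltij)).
  have le_r : (n - i <= r setT)%N.
    rewrite leqNgt; apply: contra pi => /W0 Wi.
    by rewrite -(intr_eq0 rat) coefE // Wi mulr0.
  have /W_gt0 : (n - j <= r setT)%N.
    by rewrite (leq_trans _ le_r) // leq_sub2l // ltnW.
  have : (p`_j)%:~R = 0 :> rat by rewrite pj.
  rewrite coefE // => /eqP; rewrite mulf_eq0 signr_eq0 /= => /eqP->.
  by rewrite ltxx.
have absE i : (i <= n)%N -> `|p`_i|%:~R = W (n - i)%N :> rat.
  by move=> le_i; rewrite intr_norm coefE // normrM normr_sign mul1r ger0_norm.
split=> //.
  rewrite mE => i i_gt0 ltin.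
  have le1 : (i.-1 <= n)%N by rewrite (leq_trans (leq_pred i)) // ltnW.
  rewrite -(ler_int rat) rmorphM rmorphXn /= !coefE ?(ltnW ltin) //.
  rewrite exprMn sqrr_sign mul1r mulrACA -exprD.
  rewrite (_ : (-1) ^+ _ = 1) ?mul1r ?lc_W //.
  case: i i_gt0 ltin {le1} => // i _ ltin /=.
  rewrite -(subnSK (ltnW ltin)) -(subnSK ltin) addSn addSn addnn -signr_odd.
  by rewrite /= odd_double.
apply: log_concave_unimodal.
- by move=> i; apply: normr_ge0.
- rewrite mE => i i_gt0 ltin.
  have le1 : (i.-1 <= n)%N by rewrite (leq_trans (leq_pred i)) // ltnW.
  rewrite -(ler_int rat) rmorphM rmorphXn /= !absE ?(ltnW ltin) //.
  exact: lc_W.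
move=> [i [j [l [ijl [pi pj pl]]]]]; apply: nzp; exists i, j, l; split=> //.
by rewrite normr_eq0 in pi; rewrite normr_eq0 in pl;
   split=> //; apply/eqP; rewrite -normr_eq0 pj.
Qed.
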